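(* Let $\mathcal{S}=(\sigma_{ij})\in\mathrm{SL}(2,\mathbb{Z})$ with $\mathrm{tr}(\mathcal{S})>2$ and $\Gamma_{\mathcal{S}}=\mathbb{Z}^2\rtimes_{\mathcal{S}}\mathbb{Z}$. (1) There is a one-one correspondence between the equivalence classes of central extensions $1\to\mathbb{Z}\to\tilde\Gamma\to\Gamma_{\mathcal{S}}\to1$ and the set $\mathbb{Z}\oplus\mathrm{Coker}(\mathcal{S}-I)$, where $\mathrm{Coker}(\mathcal{S}-I)=\mathbb{Z}^2/(\mathcal{S}-I)\mathbb{Z}^2$. (2) For each $\{q,(m_1,m_2)\}\in\mathbb{Z}\oplus\mathrm{Coker}(\mathcal{S}-I)$ with $q\neq0$, the corresponding extension is the group $$\tilde\Gamma_{(\mathcal{S};q,m_1,m_2)}=\langle \mathbf{t}_1,\mathbf{t}_2,\mathbf{t}_3,\tau\mid [\mathbf{t}_1,\mathbf{t}_2]=\tau^q,\ \tau\text{ central},\ \mathbf{t}_3\mathbf{t}_1\mathbf{t}_3^{-1}=\mathbf{t}_1^{\sigma_{11}}\mathbf{t}_2^{\sigma_{21}}\tau^{m_1},\ \mathbf{t}_3\mathbf{t}_2\mathbf{t}_3^{-1}=\mathbf{t}_1^{\sigma_{12}}\mathbf{t}_2^{\sigma_{22}}\tau^{m_2}\rangle$$ (with central $\mathbb{Z}=\langle\tau\rangle$), which is solvable and contains $\Gamma_q=\langle\mathbf{t}_1,\mathbf{t}_2,\tau\rangle$ as its discrete nilradical; and each of these groups embeds into $\mathrm{Sol}_1^4$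 as a lattice.
   Context: $\mathbb{Z}^2\rtimes_{\mathcal{S}}\mathbb{Z}$ is the group on $\mathbb{Z}^2\times\mathbb{Z}$ with $(\mathbf{x},m)(\mathbf{y},n)=(\mathbf{x}+\mathcal{S}^m\mathbf{y},m+n)$. $\mathrm{Sol}_1^4$ is the group of real matrices $\begin{pmatrix}1&x&z\\0&e^u&y\\0&0&1\end{pmatrix}$; a lattice is a discrete cocompact subgroup. (In the paper $\tau$ is written $\mathbf{t}_4^{1/q}$ with $\mathbf{t}_4=[\mathbf{t}_1,\mathbf{t}_2]$.)
   Formalization: Coker(S−I) is taken as Z² modulo the row image {(a,b)(S−I)}, i.e. (Sᵀ−I)Z², instead of the column image (S−I)Z²; only with rows does the class of (m₁,m₂) determine the extension (columns fail e.g. for S=[[1,1],[2,3]]). *)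

(* Defs.v *)
From Stdlib Require Import ZArith Reals Lra Lia.
Open Scope Z_scope.

Record Grp := {
  gcar :> Type;
  gop : gcar -> gcar -> gcar;
  gid : gcar;
  ginv : gcar -> gcar;
  gassoc : forall x y z, gop x (gop y z) = gop (gop x y) z;
  gid_l : forall x, gop gid x = x;
  ginv_l : forall x, gop (ginv x) x = gid }.

Arguments gop {g} _ _.
Arguments gid {g}.
Arguments ginv {g} _.

Fixpoint gpow_nat {G : Grp} (x : G) (n : nat) : G :=
  match n with O => gid | S k => gop x (gpow_nat x k) end.

Definition gpow {G : Grp} (x : G) (n : Z) : G :=
  match n with
  | Z0 => gid
  | Zpos p => gpow_nat x (Pos.to_nat p)
  | Zneg p => ginv (gpow_nat x (Pos.to_nat p))
  end.

Definition gcomm {G : Grp} (x y : G) : G :=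
  gop (gop (gop x y) (ginv x)) (ginv y).

Definition is_hom {G H : Grp} (f : G -> H) : Prop :=
  forall x y, f (gop x y) = gop (f x) (f y).

Definition is_subgroup {G : Grp} (K : G -> Prop) : Prop :=
  K gid /\ (forall x y, K x -> K y -> K (gop x y)) /\ (forall x, K x -> K (ginv x)).

Definition gen {G : Grp} (A : G -> Prop) : G -> Prop :=
  fun x => forall K : G -> Prop, is_subgroup K -> (forall y, A y -> K y) -> K x.

Definition commsub {G : Grp} (K L : G -> Prop) : G -> Prop :=
  gen (fun z => exists k l, K k /\ L l /\ z = gcomm k l).

Definition is_normal {G : Grp} (N : G -> Prop) : Prop :=
  is_subgroup N /\ forall g x, N x -> N (gop (gop g x) (ginv g)).

Fixpoint derived (G : Grp) (n : nat) : G -> Prop :=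
  match n with
  | O => fun _ => True
  | S k => commsub (derived G k) (derived G k)
  end.

Definition solvable (G : Grp) : Prop :=
  exists n, forall x, derived G n x -> x = gid.

Fixpoint lcs {G : Grp} (N : G -> Prop) (n : nat) : G -> Prop :=
  match n with
  | O => N
  | S k => commsub N (lcs N k)
  end.

Definition nilpotent_sub {G : Grp} (N : G -> Prop) : Prop :=
  exists n, forall x, lcs N n x -> x = gid.

Definition is_nilradical {G : Grp} (N : G -> Prop) : Prop :=
  is_normal N /\ nilpotent_sub N /\
  forall M : G -> Prop, is_normal M -> nilpotent_sub M -> forall x, M x -> N x.

Record M2 := mkM2 { m11 : Z; m12 : Z; m21 : Z; m22 : Z }.

Definition M2mul (A B : M2) : M2 :=
  mkM2 (m11 A * m11 B + m12 A * m21 B) (m11 A * m12 B + m12 A * m22 B)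
       (m21 A * m11 B + m22 A * m21 B) (m21 A * m12 B + m22 A * m22 B).

Definition M2id : M2 := mkM2 1 0 0 1.

(** inverse of a determinant-one matrix *)
Definition M2inv1 (A : M2) : M2 := mkM2 (m22 A) (- m12 A) (- m21 A) (m11 A).

Fixpoint M2pow_nat (A : M2) (n : nat) : M2 :=
  match n with O => M2id | S k => M2mul A (M2pow_nat A k) end.

Definition M2pow (A : M2) (m : Z) : M2 :=
  match m with
  | Z0 => M2id
  | Zpos p => M2pow_nat A (Pos.to_nat p)
  | Zneg p => M2pow_nat (M2inv1 A) (Pos.to_nat p)
  end.

Definition M2app (A : M2) (v : Z * Z) : Z * Z :=
  (m11 A * fst v + m12 A * snd v, m21 A * fst v + m22 A * snd v).

Definition GammaS_mul (S : M2) (a b : (Z * Z) * Z) : (Z * Z) * Z :=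
  let (x, m) := a in let (y, n) := b in
  let w := M2app (M2pow S m) y in
  ((fst x + fst w, snd x + snd w), m + n).

Definition GammaS_id : (Z * Z) * Z := ((0, 0), 0).

Definition is_central_ext (S : M2) (G : Grp) (iota : Z -> G)
  (pi : G -> (Z * Z) * Z) : Prop :=
  (forall a b, iota (a + b) = gop (iota a) (iota b)) /\
  (forall a b, iota a = iota b -> a = b) /\
  (forall n g, gop (iota n) g = gop g (iota n)) /\
  (forall g h, pi (gop g h) = GammaS_mul S (pi g) (pi h)) /\
  (forall c, exists g, pi g = c) /\
  (forall g, pi g = GammaS_id <-> exists n, g = iota n).

Record CExt (S : M2) := mkCExt {
  cx_grp : Grp;
  cx_iota : Z -> cx_grp;
  cx_pi : cx_grp -> (Z * Z) * Z;
  cx_ok : is_central_ext S cx_grp cx_iota cx_pi }.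

Arguments cx_grp {S} _.
Arguments cx_iota {S} _ _.
Arguments cx_pi {S} _ _.

(** equivalence of extensions: a homomorphism commuting with iota and pi
    (it is then automatically an isomorphism) *)
Definition ext_equiv {S : M2} (E1 E2 : CExt S) : Prop :=
  exists phi : cx_grp E1 -> cx_grp E2,
    is_hom phi /\ (forall n, phi (cx_iota E1 n) = cx_iota E2 n) /\
    (forall g, cx_pi E2 (phi g) = cx_pi E1 g).

(** equality in Coker(S - I) = Z^2 / Z^2 (S - I), Z^2 written as ROW vectors
    (a,b) |-> (a,b)(S - I); this is the convention in which the pair (m1,m2) of
    the presentation below is a well-defined class *)
Definition coker_eq (S : M2) (v w : Z * Z) : Prop :=
  exists a b : Z,
    fst v - fst w = (m11 S - 1) * a + m21 S * b /\
    snd v - snd w = m12 S * a + (m22 S - 1) * b.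

Definition pres_rel (S : M2) (q m1 m2 : Z) {H : Grp} (t1 t2 t3 tau : H) : Prop :=
  gcomm t1 t2 = gpow tau q /\
  gop tau t1 = gop t1 tau /\ gop tau t2 = gop t2 tau /\ gop tau t3 = gop t3 tau /\
  gop (gop t3 t1) (ginv t3) =
    gop (gop (gpow t1 (m11 S)) (gpow t2 (m21 S))) (gpow tau m1) /\
  gop (gop t3 t2) (ginv t3) =
    gop (gop (gpow t1 (m12 S)) (gpow t2 (m22 S))) (gpow tau m2).

Definition is_presented (S : M2) (q m1 m2 : Z) (P : Grp) (t1 t2 t3 tau : P) : Prop :=
  pres_rel S q m1 m2 t1 t2 t3 tau /\
  forall (H : Grp) (a1 a2 a3 b : H), pres_rel S q m1 m2 a1 a2 a3 b ->
    (exists f : P -> H, is_hom f /\ f t1 = a1 /\ f t2 = a2 /\ f t3 = a3 /\ f tau = b) /\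
    (forall f g : P -> H, is_hom f -> is_hom g ->
       f t1 = g t1 -> f t2 = g t2 -> f t3 = g t3 -> f tau = g tau ->
       forall x, f x = g x).

Open Scope R_scope.

Definition M3 := nat -> nat -> R.

Definition mmul3 (A B : M3) : M3 :=
  fun i j => A i 0%nat * B 0%nat j + A i 1%nat * B 1%nat j + A i 2%nat * B 2%nat j.

Definition R4 := (R * R * R * R)%type.

Definition sol_mx (c : R4) : M3 :=
  let '(x, y, z, u) := c in
  fun i j =>
    match i, j with
    | 0%nat, 0%nat => 1
    | 0%nat, 1%nat => x
    | 0%nat, 2%nat => z
    | 1%nat, 1%nat => exp u
    | 1%nat, 2%nat => y
    | 2%nat, 2%nat => 1
    | _, _ => 0
    end.

Definition mx3_eq (A B : M3) : Prop :=
  forall i j, (i < 3)%nat -> (j < 3)%nat -> A i j = B i j.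

Definition R4_bounded (B : R) (c : R4) : Prop :=
  let '(x, y, z, u) := c in
  Rabs x <= B /\ Rabs y <= B /\ Rabs z <= B /\ Rabs u <= B.

Definition R4_small (eps : R) (c : R4) : Prop :=
  let '(x, y, z, u) := c in
  Rabs x < eps /\ Rabs y < eps /\ Rabs z < eps /\ Rabs u < eps.

(** rho : P -> Sol_1^4 (via coordinates) is an injective homomorphism whose
    image is a lattice: discrete (a neighbourhood of the identity meets the image
    only in the identity) and cocompact (Sol = image * K for a compact K; every
    compact set lies in a coordinate box and boxes are compact). *)
Definition sol_lattice_embedding (P : Grp) (rho : P -> R4) : Prop :=
  (forall g h, rho g = rho h -> g = h) /\
  (forall g h, mx3_eq (sol_mx (rho (gop g h))) (mmul3 (sol_mx (rho g)) (sol_mx (rho h)))) /\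
  (exists eps, 0 < eps /\ forall g, R4_small eps (rho g) -> g = gid) /\
  (exists B, forall c : R4, exists (g : P) (k : R4),
      R4_bounded B k /\ mx3_eq (sol_mx c) (mmul3 (sol_mx (rho g)) (sol_mx k))).

Close Scope R_scope.

(* Main.v *)
Require Import Defs.
From Stdlib Require Import ZArith Reals Lra Lia ClassicalEpsilon.
Open Scope Z_scope.

(** Lifting the generators of [Z^2 x| Z] to [t1, t2, t3] in a central extension, the
    commutator of [t1, t2] and the two conjugation relations define integers [q, m1, m2].
    Multiplying the lifts by central elements fixes [q] and moves [(m1, m2)] by the row
    image of [S - I], so the class of [(q, (m1, m2))] is an invariant.  The presented group
    is realised as [H_q x| Z], where [H_q] is the Heisenberg group with [t1 t2 = t2 t1 tau^q]
    and [Z] acts through the lift of [S] prescribed by [m1, m2]; it maps isomorphically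
    onto every extension with these invariants.  An element outside [H_q] acts on [Z^2] by
    some [S^n], [n <> 0], which has no nonzero fixed vector, and this excludes it from any
    normal nilpotent subgroup.  For [q <> 0], left eigenvectors of [S] give the off-diagonal
    coordinates of [t1, t2] in [Sol_1^4]; the corner entries are then forced by a linear
    system that is solvable because [det (S - I) = 2 - tr S] does not vanish. *)

(** * Groups and integer powers *)

(** The step is an equivalence because the steps below multiply by a group element or apply a
    bijection. The upward direction is a rewrite and the downward one a cancellation, so no case
    split on signs arises. *)
Lemma Z_bi_ind (P : Z -> Prop) :
  P 0 -> (forall n, P n <-> P (n + 1)) -> forall n, P n.
Proof.
  intros H0 Hs n. induction n as [|n IH|n IH] using Z.peano_ind; auto.
  - rewrite <- Z.add_1_r. now apply (proj1 (Hs n)).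
  - apply (proj2 (Hs _)). now replace (Z.pred n + 1) with n by lia.
Qed.

Ltac zinduction m := pattern m; apply Z_bi_ind; clear m; cbv beta; [|intros m].

Lemma gcancel_l {G : Grp} (x y z : G) : gop x y = gop x z -> y = z.
Proof.
  intros H. rewrite <- (gid_l _ y), <- (gid_l _ z), <- (ginv_l _ x), <- !gassoc.
  now rewrite H.
Qed.

Lemma ginv_r {G : Grp} (x : G) : gop x (ginv x) = gid.
Proof.
  apply (gcancel_l (ginv x)). rewrite gassoc, ginv_l, gid_l.
  apply (gcancel_l (ginv (ginv x))).
  now rewrite gassoc, ginv_l, gid_l.
Qed.

Lemma gid_r {G : Grp} (x : G) : gop x gid = x.
Proof. now rewrite <- (ginv_l _ x), gassoc, ginv_r, gid_l. Qed.

Lemma gcancel_r {G : Grp} (x y z : G) : gop y x = gop z x -> y = z.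
Proof.
  intros H. rewrite <- (gid_r y), <- (gid_r z), <- (ginv_r x), !gassoc.
  now rewrite H.
Qed.

Lemma gopK {G : Grp} (x y : G) : gop (gop x y) (ginv y) = x.
Proof. now rewrite <- gassoc, ginv_r, gid_r. Qed.

Lemma gopVK {G : Grp} (x y : G) : gop (gop x (ginv y)) y = x.
Proof. now rewrite <- gassoc, ginv_l, gid_r. Qed.

Lemma ginv_unique {G : Grp} (x y : G) : gop x y = gid -> x = ginv y.
Proof. intros H. apply (gcancel_r y). now rewrite H, ginv_l. Qed.

Lemma ginv_mul {G : Grp} (x y : G) : ginv (gop x y) = gop (ginv y) (ginv x).
Proof.
  symmetry. apply ginv_unique.
  now rewrite gassoc, gopVK, ginv_l.
Qed.

Lemma ginv_id {G : Grp} : ginv (@gid G) = gid.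
Proof. symmetry. apply ginv_unique, gid_l. Qed.

Lemma gidem_id {G : Grp} (x : G) : gop x x = x -> x = gid.
Proof. intros H. apply (gcancel_l x). now rewrite H, gid_r. Qed.

Lemma hom_id {G H : Grp} (f : G -> H) : is_hom f -> f gid = gid.
Proof. intros Hf. apply gidem_id. now rewrite <- Hf, gid_l. Qed.

Lemma hom_inv {G H : Grp} (f : G -> H) (x : G) :
  is_hom f -> f (ginv x) = ginv (f x).
Proof. intros Hf. apply ginv_unique. rewrite <- Hf, ginv_l. now apply hom_id. Qed.

Lemma hom_comm {G H : Grp} (f : G -> H) (x y : G) :
  is_hom f -> f (gcomm x y) = gcomm (f x) (f y).
Proof. intros Hf. unfold gcomm. now rewrite !Hf, !(hom_inv f) by easy. Qed.

Lemma gcomm_mul {G : Grp} (x y : G) : gop (gcomm x y) (gop y x) = gop x y.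
Proof. unfold gcomm. now rewrite gassoc, !gopVK. Qed.

Lemma gcomm_unique {G : Grp} (x y c : G) :
  gop c (gop y x) = gop x y -> gcomm x y = c.
Proof. intros H. apply (gcancel_r (gop y x)). now rewrite gcomm_mul. Qed.

Lemma gcomm_eq_id {G : Grp} (x y : G) : gop x y = gop y x -> gcomm x y = gid.
Proof. intros H. apply gcomm_unique. now rewrite gid_l. Qed.

Lemma gpow_nat_comm {G : Grp} (x : G) (k : nat) :
  gop x (gpow_nat x k) = gop (gpow_nat x k) x.
Proof.
  induction k as [|k IH]; simpl; [now rewrite gid_l, gid_r|].
  now rewrite <- gassoc, <- IH.
Qed.

Lemma gpow_of_nat {G : Grp} (x : G) (k : nat) :
  gpow x (Z.of_nat k) = gpow_nat x k.
Proof. destruct k; simpl; [easy|]. now rewrite SuccNat2Pos.id_succ. Qed.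

Lemma gpow_opp_of_nat {G : Grp} (x : G) (k : nat) :
  gpow x (- Z.of_nat k) = ginv (gpow_nat x k).
Proof.
  destruct k; simpl; [now rewrite ginv_id|]. now rewrite SuccNat2Pos.id_succ.
Qed.

Lemma Z_nat_cases (n : Z) :
  (exists k : nat, n = Z.of_nat k) \/ (exists k : nat, n = - Z.of_nat (S k)).
Proof.
  destruct (Z_le_dec 0 n) as [H|H].
  - left. exists (Z.to_nat n). lia.
  - right. exists (Z.to_nat (- n - 1)). lia.
Qed.

Lemma gpow_succ {G : Grp} (x : G) (n : Z) : gpow x (n + 1) = gop x (gpow x n).
Proof.
  destruct (Z_nat_cases n) as [[k ->]|[k ->]].
  - replace (Z.of_nat k + 1) with (Z.of_nat (S k)) by lia.
    now rewrite !gpow_of_nat.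
  - replace (- Z.of_nat (S k) + 1) with (- Z.of_nat k) by lia.
    rewrite !gpow_opp_of_nat. simpl.
    now rewrite gpow_nat_comm, ginv_mul, gassoc, ginv_r, gid_l.
Qed.

Lemma gpow_add {G : Grp} (x : G) (m n : Z) :
  gpow x (m + n) = gop (gpow x m) (gpow x n).
Proof.
  zinduction m; [now rewrite gid_l|].
  replace (m + 1 + n) with (m + n + 1) by ring.
  rewrite !gpow_succ, <- gassoc. split; intros H; [now rewrite H|].
  now apply gcancel_l in H.
Qed.

Lemma gpow_0 {G : Grp} (x : G) : gpow x 0 = gid.
Proof. reflexivity. Qed.

Lemma gpow_1 {G : Grp} (x : G) : gpow x 1 = x.
Proof. apply gid_r. Qed.

(** Powers in a concrete group are computed by guessing a closed formula and checking that it is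
    additive in the exponent. This serves the Heisenberg group, the model, [GammaS_grp] and
    [sol_grp] alike. *)
Lemma additive_gpow {G : Grp} (h : Z -> G) (n : Z) :
  (forall a b, h (a + b) = gop (h a) (h b)) -> h n = gpow (h 1) n.
Proof.
  intros Hh. assert (H0 : h 0 = gid) by (apply gidem_id; now rewrite <- Hh).
  zinduction n; [easy|].
  rewrite gpow_succ, Z.add_comm, Hh. split; intros H; [now rewrite H|].
  now apply gcancel_l in H.
Qed.

Lemma hom_gpow {G H : Grp} (f : G -> H) (x : G) (n : Z) :
  is_hom f -> f (gpow x n) = gpow (f x) n.
Proof.
  intros Hf. rewrite (additive_gpow (fun n => f (gpow x n))).
  - now rewrite gpow_1.
  - intros a b. now rewrite gpow_add, Hf.
Qed.

Lemma gpow_commute {G : Grp} (x y : G) (n : Z) :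
  gop x y = gop y x -> gop (gpow x n) y = gop y (gpow x n).
Proof.
  intros Hxy. zinduction n.
  - simpl. now rewrite gid_l, gid_r.
  - rewrite gpow_succ, <- gassoc, (gassoc _ y), <- Hxy, <- (gassoc _ x y).
    split; intros H; [now rewrite H|]. now apply gcancel_l in H.
Qed.

Lemma conj_gpow {G : Grp} (g x : G) (n : Z) :
  gop (gop g (gpow x n)) (ginv g) = gpow (gop (gop g x) (ginv g)) n.
Proof.
  apply (hom_gpow (fun y => gop (gop g y) (ginv g))).
  intros y z. now rewrite !gassoc, gopVK.
Qed.

Lemma gpow_mul_central {G : Grp} (x z : G) (n : Z) :
  gop z x = gop x z -> gpow (gop x z) n = gop (gpow x n) (gpow z n).
Proof.
  intros Hz. rewrite (additive_gpow (fun n => gop (gpow x n) (gpow z n))).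
  - now rewrite !gpow_1.
  - intros a b. rewrite !gpow_add, !gassoc. f_equal.
    rewrite <- !gassoc. f_equal.
    apply eq_sym, gpow_commute. symmetry. now apply gpow_commute.
Qed.

Lemma gpow_gpow {G : Grp} (x : G) (m n : Z) : gpow (gpow x m) n = gpow x (m * n).
Proof.
  rewrite (additive_gpow (fun n => gpow x (m * n))).
  - now rewrite Z.mul_1_r.
  - intros a b. now rewrite Z.mul_add_distr_l, gpow_add.
Qed.

Lemma gen_subgroup {G : Grp} (A : G -> Prop) : is_subgroup (gen A).
Proof.
  repeat split.
  - now intros K (H & _) _.
  - intros x y Hx Hy K HK HA. apply HK; [apply Hx|apply Hy]; auto.
  - intros x Hx K HK HA. apply HK, Hx; auto.
Qed.

Lemma subgroup_gpow {G : Grp} (K : G -> Prop) (x : G) (n : Z) :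
  is_subgroup K -> K x -> K (gpow x n).
Proof.
  intros (H1 & Hm & Hi) Hx.
  assert (Hn : forall k, K (gpow_nat x k)) by (induction k; simpl; auto).
  destruct n; simpl; auto.
Qed.

Lemma commsub_incl {G : Grp} (K L N : G -> Prop) :
  is_subgroup N -> (forall k l, K k -> L l -> N (gcomm k l)) ->
  forall x, commsub K L x -> N x.
Proof. intros HN H x Hx. apply Hx; [easy|]. intros y (k & l & Hk & Hl & ->). auto. Qed.

(** * Integer iteration of a bijection and powers in SL(2,Z) *)

(** [g] stands for the inverse of [f]. The case split mirrors [M2pow], so that one iteration
    describes both the powers of [S] on [Z^2] and the action of [Z] on the Heisenberg group. *)
Definition ziter {T : Type} (f g : T -> T) (n : Z) (x : T) : T :=
  match n with
  | Z0 => x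
  | Zpos p => Nat.iter (Pos.to_nat p) f x
  | Zneg p => Nat.iter (Pos.to_nat p) g x
  end.

Lemma ziter_of_nat {T : Type} (f g : T -> T) (k : nat) (x : T) :
  ziter f g (Z.of_nat k) x = Nat.iter k f x.
Proof. destruct k; simpl; [easy|]. now rewrite SuccNat2Pos.id_succ. Qed.

Lemma ziter_opp_of_nat {T : Type} (f g : T -> T) (k : nat) (x : T) :
  ziter f g (- Z.of_nat k) x = Nat.iter k g x.
Proof. destruct k; simpl; [easy|]. now rewrite SuccNat2Pos.id_succ. Qed.

Lemma ziter_succ {T : Type} (f g : T -> T) (n : Z) (x : T) :
  (forall y, f (g y) = y) -> ziter f g (n + 1) x = f (ziter f g n x).
Proof.
  intros Hfg. destruct (Z_nat_cases n) as [[k ->]|[k ->]].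
  - replace (Z.of_nat k + 1) with (Z.of_nat (S k)) by lia.
    now rewrite !ziter_of_nat.
  - replace (- Z.of_nat (S k) + 1) with (- Z.of_nat k) by lia.
    rewrite !ziter_opp_of_nat. simpl. now rewrite Hfg.
Qed.

Lemma ziter_add {T : Type} (f g : T -> T) (m n : Z) (x : T) :
  (forall y, f (g y) = y) -> (forall y, g (f y) = y) ->
  ziter f g (m + n) x = ziter f g m (ziter f g n x).
Proof.
  intros Hfg Hgf. zinduction m; [easy|].
  replace (m + 1 + n) with (m + n + 1) by ring.
  rewrite !ziter_succ by easy. split; intros H; [now rewrite H|].
  rewrite <- (Hgf (ziter f g (m + n) x)), H. apply Hgf.
Qed.

Lemma ziter_hom {N : Grp} (f g : N -> N) (n : Z) :
  is_hom f -> (forall y, f (g y) = y) -> (forall y, g (f y) = y) ->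
  is_hom (ziter f g n).
Proof.
  intros Hf Hfg Hgf. zinduction n; [easy|].
  split; intros H x y.
  - now rewrite !ziter_succ, H.
  - specialize (H x y). rewrite !ziter_succ, <- Hf in H by easy.
    rewrite <- (Hgf (ziter f g n (gop x y))), H. apply Hgf.
Qed.

Definition vadd (v w : Z * Z) : Z * Z := (fst v + fst w, snd v + snd w).

Definition M2det (A : M2) : Z := m11 A * m22 A - m12 A * m21 A.

Lemma M2app_add (A : M2) (v w : Z * Z) :
  M2app A (vadd v w) = vadd (M2app A v) (M2app A w).
Proof. unfold M2app, vadd; simpl. f_equal; ring. Qed.

Lemma M2app_mul (A B : M2) (v : Z * Z) :
  M2app (M2mul A B) v = M2app A (M2app B v).
Proof. unfold M2app, M2mul; simpl. f_equal; ring. Qed.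

Lemma M2app_id (v : Z * Z) : M2app M2id v = v.
Proof. destruct v. unfold M2app; cbn [m11 m12 m21 m22 M2id fst snd]. f_equal; ring. Qed.

Lemma M2mul_inv1_r (A : M2) : M2det A = 1 -> M2mul A (M2inv1 A) = M2id.
Proof.
  unfold M2mul, M2inv1, M2id, M2det; simpl. intros H. f_equal; try ring; lia.
Qed.

Lemma M2mul_inv1_l (A : M2) : M2det A = 1 -> M2mul (M2inv1 A) A = M2id.
Proof.
  unfold M2mul, M2inv1, M2id, M2det; simpl. intros H. f_equal; try ring; lia.
Qed.

Lemma M2app_inv1_r (A : M2) (v : Z * Z) :
  M2det A = 1 -> M2app A (M2app (M2inv1 A) v) = v.
Proof. intros H. now rewrite <- M2app_mul, M2mul_inv1_r, M2app_id. Qed.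

Lemma M2app_inv1_l (A : M2) (v : Z * Z) :
  M2det A = 1 -> M2app (M2inv1 A) (M2app A v) = v.
Proof. intros H. now rewrite <- M2app_mul, M2mul_inv1_l, M2app_id. Qed.

Lemma M2app_pow_nat (A : M2) (k : nat) (v : Z * Z) :
  M2app (M2pow_nat A k) v = Nat.iter k (M2app A) v.
Proof.
  induction k as [|k IH]; simpl; [apply M2app_id|].
  now rewrite M2app_mul, IH.
Qed.

Lemma M2app_pow (A : M2) (n : Z) (v : Z * Z) :
  M2app (M2pow A n) v = ziter (M2app A) (M2app (M2inv1 A)) n v.
Proof. destruct n; simpl; [apply M2app_id|apply M2app_pow_nat..]. Qed.

Lemma M2app_pow_add (A : M2) (m n : Z) (v : Z * Z) : M2det A = 1 ->
  M2app (M2pow A (m + n)) v = M2app (M2pow A m) (M2app (M2pow A n) v).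
Proof.
  intros H. rewrite !M2app_pow. apply ziter_add; intros y.
  - now apply M2app_inv1_r.
  - now apply M2app_inv1_l.
Qed.

Lemma M2app_zero (A : M2) : M2app A (0, 0) = (0, 0).
Proof. unfold M2app; simpl. f_equal; ring. Qed.

(* The trace of the powers satisfies [t (k+2) = t * t (k+1) - t k], hence increases. *)
Lemma trace_pow_gt2 (A : M2) (k : nat) :
  M2det A = 1 -> m11 A + m22 A > 2 ->
  let B := M2pow_nat A (S k) in M2det B = 1 /\ m11 B + m22 B > 2.
Proof.
  intros Hd Ht.
  assert (Hdet : forall j, M2det (M2pow_nat A j) = 1).
  { induction j as [|j IH]; [easy|]. simpl. unfold M2det in *. simpl.
    (* The right side becomes a product of two determinants, which reduces the goal to
       multiplicativity of the determinant. *)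
    rewrite <- (Z.mul_1_r 1). rewrite <- Hd at 1. rewrite <- IH. ring. }
  intros B. split; [apply Hdet|]. subst B.
  set (t := m11 A + m22 A) in *.
  set (tr := fun j => m11 (M2pow_nat A j) + m22 (M2pow_nat A j)).
  assert (Hrec : forall j, tr (S (S j)) = t * tr (S j) - tr j).
  { intros j. unfold tr. simpl. destruct (M2pow_nat A j) as [a b c d]. simpl.
    unfold t, M2det in *.
    replace (a + d) with ((a + d) * (m11 A * m22 A - m12 A * m21 A))
      by (rewrite Hd; ring). ring. }
  change (tr (S k) > 2).
  (* The recurrence involves two successive traces, so monotonicity is carried along: with [t >= 3]
     and [x > y], [x > 2], one has [t * x - y > (t - 1) * x > x]. It starts from [tr 0 = 2]. *)
  assert (H : tr (S k) > 2 /\ tr (S k) > tr k); [|easy].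
  induction k as [|k IH].
  - unfold tr; simpl. unfold t in Ht. lia.
  - rewrite Hrec. nia.
Qed.

Lemma M2app_pow_fixed (A : M2) (n : Z) (v : Z * Z) :
  M2det A = 1 -> m11 A + m22 A > 2 -> n <> 0 ->
  M2app (M2pow A n) v = v -> v = (0, 0).
Proof.
  assert (Hfix : forall B, M2det B = 1 /\ m11 B + m22 B > 2 ->
                 M2app B v = v -> v = (0, 0)).
  { intros [a b c d] [H1 H2]. destruct v as [x y].
    unfold M2app, M2det in *; simpl in *.
    intros H. injection H as Hx Hy.
    (* [det (B - I) = 2 - tr B], and [det (B - I)] kills every fixed vector *)
    assert (Ex : (2 - (a + d)) * x = 0).
    { replace ((2 - (a + d)) * x) with (((a * d - b * c) + 1 - (a + d)) * x)
        by (rewrite H1; ring).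
      transitivity ((d - 1) * (a * x + b * y - x) - b * (c * x + d * y - y)); [ring|].
      rewrite Hx, Hy; ring. }
    assert (Ey : (2 - (a + d)) * y = 0).
    { replace ((2 - (a + d)) * y) with (((a * d - b * c) + 1 - (a + d)) * y)
        by (rewrite H1; ring).
      transitivity ((a - 1) * (c * x + d * y - y) - c * (a * x + b * y - x)); [ring|].
      rewrite Hx, Hy; ring. }
    apply Z.mul_eq_0 in Ex. apply Z.mul_eq_0 in Ey. f_equal; lia. }
  intros Hd Ht Hn. apply Hfix. destruct n as [|p|p]; [easy|..]; simpl;
    destruct (Pos2Nat.is_succ p) as [k ->]; apply trace_pow_gt2; try easy.
  (* A negative power of [A] is a positive power of [M2inv1 A], which has the same determinant and
     trace as [A]. *)
  - unfold M2det, M2inv1 in *; simpl. lia.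
  - unfold M2inv1; simpl. lia.
Qed.

Definition GammaS_inv (A : M2) (a : (Z * Z) * Z) : (Z * Z) * Z :=
  (M2app (M2pow A (- snd a)) (- fst (fst a), - snd (fst a)), - snd a).

Lemma GammaS_mul_eq (A : M2) (v w : Z * Z) (m n : Z) :
  GammaS_mul A (v, m) (w, n) = (vadd v (M2app (M2pow A m) w), m + n).
Proof. reflexivity. Qed.

(** [is_central_ext] sends [pi] to a bare set of triples with a product. With this structure on the
    target, [hom_id], [hom_inv] and [hom_gpow] apply to [pi]. *)
Definition GammaS_grp (A : M2) (hA : M2det A = 1) : Grp.
Proof.
  refine (Build_Grp ((Z * Z) * Z) (GammaS_mul A) GammaS_id (GammaS_inv A) _ _ _).
  - intros [v l] [w m] [x n]. rewrite !GammaS_mul_eq.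
    rewrite M2app_add, M2app_pow_add by easy.
    unfold vadd; simpl. f_equal; [f_equal|]; ring.
  - intros [v m]. unfold GammaS_id. rewrite GammaS_mul_eq.
    destruct v as [a b]. simpl M2pow. now rewrite M2app_id.
  - intros [[a b] m]. unfold GammaS_inv. simpl fst; simpl snd. rewrite GammaS_mul_eq.
    rewrite <- M2app_add. unfold vadd; simpl fst; simpl snd.
    rewrite !Z.add_opp_diag_l. now rewrite M2app_zero.
Defined.

(** * The extension with given invariants *)

Definition semidirect (N : Grp) (act : Z -> N -> N)
  (act_hom : forall n, is_hom (act n)) (act_0 : forall x, act 0 x = x)
  (act_add : forall m n x, act (m + n) x = act m (act n x)) : Grp.
Proof.
  refine (Build_Grp (N * Z)
    (fun g h => (gop (fst g) (act (snd g) (fst h)), snd g + snd h))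
    (gid, 0) (fun g => (act (- snd g) (ginv (fst g)), - snd g)) _ _ _).
  - intros [x l] [y m] [z n]; simpl.
    now rewrite (act_hom l), act_add, gassoc, Z.add_assoc.
  - intros [x n]; simpl. now rewrite gid_l, act_0.
  - intros [x n]; simpl.
    now rewrite <- (act_hom (- n)), ginv_l, (hom_id _ (act_hom _)), Z.add_opp_diag_l.
Defined.

(** The binomial coefficient [a] over 2, extended to negative [a]. Collecting [(t1^r t2^s)^a] into
    [t1^(r a) t2^(s a)] moves [t2] past [t1] a total of [r * s * tri a] times, counted with sign. *)
Definition tri (a : Z) : Z := a * (a - 1) / 2.

Lemma tri_double (a : Z) : 2 * tri a = a * (a - 1).
Proof.
  unfold tri. rewrite <- Z.divide_div_mul_exact; [|lia|].
  - rewrite Z.mul_comm. now apply Z.div_mul.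
  - destruct (Z.Even_or_Odd a) as [[k ->]|[k ->]].
    + exists (k * (2 * k - 1)). ring.
    + exists ((2 * k + 1) * k). ring.
Qed.

Lemma tri_add (a b : Z) : tri (a + b) = tri a + tri b + a * b.
Proof.
  pose proof (tri_double (a + b)). pose proof (tri_double a).
  pose proof (tri_double b). nia.
Qed.

Ltac pair_ring := repeat (apply pair_equal_spec; split);
  change (tri 0) with 0; change (tri 1) with 0; ring.

(* [(a, b, c)] stands for [t1^a t2^b tau^c], where [t2 t1 = t1 t2 tau^(-q)]. *)
Definition heis (q : Z) : Grp.
Proof.
  refine (Build_Grp (Z * Z * Z)
    (fun x y => let '(a, b, c) := x in let '(a', b', c') := y in
                (a + a', b + b', c + c' - q * b * a'))
    (0, 0, 0)
    (fun x => let '(a, b, c) := x in (- a, - b, - c - q * a * b)) _ _ _).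
  - intros [[a b] c] [[a' b'] c'] [[a'' b''] c'']. pair_ring.
  - intros [[a b] c]. pair_ring.
  - intros [[a b] c]. pair_ring.
Defined.

(* The exponent of [tau] in [(t1^s11 t2^s21 tau^m1)^a (t1^s12 t2^s22 tau^m2)^b]. *)
Definition twist (A : M2) (q m1 m2 a b : Z) : Z :=
  m1 * a + m2 * b
  - q * (m11 A * m21 A * tri a + m12 A * m22 A * tri b + m21 A * m12 A * a * b).

Definition heis_aut (A : M2) (q m1 m2 : Z) (x : heis q) : heis q :=
  let '(a, b, c) := x in (M2app A (a, b), c + twist A q m1 m2 a b).

Definition heis_aut_inv (A : M2) (q m1 m2 : Z) (x : heis q) : heis q :=
  let '(v, c) := x in
  let w := M2app (M2inv1 A) v in (w, c - twist A q m1 m2 (fst w) (snd w)).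

Lemma heis_autK (A : M2) (q m1 m2 : Z) (x : heis q) : M2det A = 1 ->
  heis_aut_inv A q m1 m2 (heis_aut A q m1 m2 x) = x.
Proof.
  intros H. destruct x as [[a b] c]. unfold heis_aut, heis_aut_inv.
  rewrite M2app_inv1_l by easy. simpl fst; simpl snd. f_equal; ring.
Qed.

Lemma heis_aut_invK (A : M2) (q m1 m2 : Z) (x : heis q) : M2det A = 1 ->
  heis_aut A q m1 m2 (heis_aut_inv A q m1 m2 x) = x.
Proof.
  intros H. destruct x as [v c]. unfold heis_aut, heis_aut_inv.
  destruct (M2app (M2inv1 A) v) as [a b] eqn:E. rewrite <- E, M2app_inv1_r by easy.
  rewrite E. cbn [fst snd]. f_equal; ring.
Qed.

Lemma heis_aut_hom (A : M2) (q m1 m2 : Z) : M2det A = 1 ->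
  is_hom (heis_aut A q m1 m2).
Proof.
  intros H [[a b] c] [[a' b'] c']. unfold heis_aut, M2app, twist, M2det in *; simpl.
  rewrite !tri_add. f_equal; [f_equal; ring|].
  (* The polarisation of [twist] accounts for all terms except those in [b * a'], where the two
     sides differ by a multiple of [det A - 1]. *)
  replace (q * b * a') with (q * b * a' * (m11 A * m22 A - m12 A * m21 A))
    by (rewrite H; ring).
  ring.
Qed.

Definition heis_act (A : M2) (q m1 m2 : Z) : Z -> heis q -> heis q :=
  ziter (heis_aut A q m1 m2) (heis_aut_inv A q m1 m2).

Lemma heis_act_hom (A : M2) (q m1 m2 : Z) (hA : M2det A = 1) (n : Z) :
  is_hom (heis_act A q m1 m2 n).
Proof.
  apply ziter_hom; [now apply heis_aut_hom|..]; intros y;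
    [now apply heis_aut_invK|now apply heis_autK].
Qed.

Lemma heis_act_add (A : M2) (q m1 m2 : Z) (hA : M2det A = 1) (m n : Z) (x : heis q) :
  heis_act A q m1 m2 (m + n) x = heis_act A q m1 m2 m (heis_act A q m1 m2 n x).
Proof.
  apply ziter_add; intros y; [now apply heis_aut_invK|now apply heis_autK].
Qed.

Definition model (A : M2) (hA : M2det A = 1) (q m1 m2 : Z) : Grp :=
  semidirect (heis q) (heis_act A q m1 m2) (heis_act_hom A q m1 m2 hA)
    (fun x => eq_refl) (heis_act_add A q m1 m2 hA).

Definition model_pi (A : M2) (hA : M2det A = 1) (q m1 m2 : Z)
  (g : model A hA q m1 m2) : (Z * Z) * Z := (fst (fst g), snd g).

Lemma heis_act_fst (A : M2) (q m1 m2 : Z) (hA : M2det A = 1) (n : Z) (x : heis q) :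
  fst (heis_act A q m1 m2 n x) = M2app (M2pow A n) (fst x).
Proof.
  rewrite M2app_pow. unfold heis_act.
  destruct (Z_nat_cases n) as [[k ->]|[k ->]];
    rewrite ?ziter_of_nat, ?ziter_opp_of_nat.
  - induction k as [|k IH]; [easy|]. cbn [Nat.iter nat_rect].
    unfold Nat.iter in *. rewrite <- IH.
    now destruct (nat_rect _ _ _ k) as [[a b] c].
  - generalize (S k); clear k; intros k.
    induction k as [|k IH]; [easy|]. cbn [Nat.iter nat_rect].
    unfold Nat.iter in *. rewrite <- IH.
    now destruct (nat_rect _ _ _ k) as [v c].
Qed.

Lemma heis_gpow_t1 (q a : Z) : @gpow (heis q) (1, 0, 0) a = (a, 0, 0).
Proof.
  symmetry. apply (additive_gpow (fun a => (a, 0, 0) : heis q)).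
  intros x y. simpl. pair_ring.
Qed.

Lemma heis_gpow_t2 (q b : Z) : @gpow (heis q) (0, 1, 0) b = (0, b, 0).
Proof.
  symmetry. apply (additive_gpow (fun b => (0, b, 0) : heis q)).
  intros x y. simpl. pair_ring.
Qed.

Lemma heis_gpow_tau (q c : Z) : @gpow (heis q) (0, 0, 1) c = (0, 0, c).
Proof.
  symmetry. apply (additive_gpow (fun c => (0, 0, c) : heis q)).
  intros x y. simpl. pair_ring.
Qed.

(** * Collection of words in groups satisfying the relations *)

Definition word {G : Grp} (t1 t2 tau : G) (a b c : Z) : G :=
  gop (gop (gpow t1 a) (gpow t2 b)) (gpow tau c).

Ltac word_ring := apply f_equal2; [apply f_equal2|]; apply f_equal;
  change (tri 0) with 0; change (tri 1) with 0; ring.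

Lemma hom_word {G H : Grp} (f : G -> H) (t1 t2 tau : G) (a b c : Z) : is_hom f ->
  f (word t1 t2 tau a b c) = word (f t1) (f t2) (f tau) a b c.
Proof. intros Hf. unfold word. now rewrite !Hf, !(hom_gpow f) by easy. Qed.

Lemma heis_word (q a b c : Z) :
  ((a, b, c) : heis q) = word ((1, 0, 0) : heis q) (0, 1, 0) (0, 0, 1) a b c.
Proof.
  unfold word. rewrite heis_gpow_t1, heis_gpow_t2, heis_gpow_tau. simpl.
  pair_ring.
Qed.

Lemma heis_hom_ext {q : Z} {H : Grp} (f g : heis q -> H) :
  is_hom f -> is_hom g -> f (1, 0, 0) = g (1, 0, 0) -> f (0, 1, 0) = g (0, 1, 0) ->
  f (0, 0, 1) = g (0, 0, 1) -> forall x, f x = g x.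
Proof.
  intros Hf Hg E1 E2 E3 [[a b] c].
  rewrite (heis_word q), (hom_word f), (hom_word g) by easy. now rewrite E1, E2, E3.
Qed.

(** The collection rule behind the multiplication of [heis]. Conjugating whole powers instead of
    swapping single letters treats exponents of either sign at once. *)
Lemma gpow_comm_swap {G : Grp} (t1 t2 tau : G) (q a b : Z) :
  gcomm t1 t2 = gpow tau q -> gop tau t1 = gop t1 tau -> gop tau t2 = gop t2 tau ->
  gop (gpow t2 b) (gpow t1 a) =
  gop (gop (gpow t1 a) (gpow t2 b)) (gpow tau (- q * b * a)).
Proof.
  intros Hc H1 H2.
  assert (Hz : forall n x, gop tau x = gop x tau ->
                           gop (gpow tau n) x = gop x (gpow tau n))
    by (intros; now apply gpow_commute).
  (* [t2 t1^a t2^-1 = (t1 tau^-q)^a], then conjugate [t2^b] by [t1^a] *)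
  assert (E1 : gop (gop t2 t1) (ginv t2) = gop t1 (gpow tau (- q))).
  { apply (gcancel_r t2). rewrite gopVK, <- gassoc, Hz, gassoc by easy.
    apply (gcancel_r (gpow tau q)). rewrite <- (gassoc _ (gop t1 t2)), <- gpow_add.
    rewrite Z.add_opp_diag_l. simpl. rewrite gid_r, <- (gcomm_mul t1 t2), Hc.
    rewrite (gassoc _ (gpow tau q)), Hz, <- !gassoc by easy. f_equal.
    symmetry. now apply Hz. }
  assert (E2 : gop (gop t2 (gpow t1 a)) (ginv t2)
               = gop (gpow t1 a) (gpow tau (- q * a))).
  { rewrite conj_gpow, E1, gpow_mul_central, gpow_gpow; [easy|]. now apply Hz. }
  assert (E3 : gop (gop (ginv (gpow t1 a)) t2) (gpow t1 a)
               = gop t2 (gpow tau (- q * a))).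
  { apply (gcancel_l (gpow t1 a)). rewrite !gassoc, ginv_r, gid_l.
    apply (gcancel_r (ginv t2)). rewrite E2, <- (gassoc _ (gpow t1 a)), <- (Hz _ t2) by easy.
    now rewrite !gassoc, gopK. }
  pose proof (conj_gpow (ginv (gpow t1 a)) t2 b) as E4.
  assert (Hi : ginv (ginv (gpow t1 a)) = gpow t1 a)
    by (symmetry; apply ginv_unique, ginv_r).
  rewrite Hi, E3, gpow_mul_central, gpow_gpow in E4 by now apply Hz.
  apply (gcancel_l (ginv (gpow t1 a))). rewrite gassoc, E4, !gassoc, ginv_l, gid_l.
  do 2 f_equal. ring.
Qed.

(** The universal property of [heis q]: once the central powers of [tau] are moved to the right, the
    only noncommuting swap is that of [t2^b] with [t1^a']. *)
Lemma word_hom {G : Grp} (t1 t2 tau : G) (q : Z) :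
  gcomm t1 t2 = gpow tau q -> gop tau t1 = gop t1 tau -> gop tau t2 = gop t2 tau ->
  is_hom (fun x : heis q => let '(a, b, c) := x in word t1 t2 tau a b c).
Proof.
  intros Hc H1 H2 [[a b] c] [[a' b'] c']. unfold word; simpl.
  assert (Hz : forall n x, gop tau x = gop x tau ->
                           gop (gpow tau n) x = gop x (gpow tau n))
    by (intros; now apply gpow_commute).
  assert (Z1 : forall n m, gop (gpow tau n) (gpow t1 m) = gop (gpow t1 m) (gpow tau n))
    by (intros; apply Hz; symmetry; now apply gpow_commute).
  assert (Z2 : forall n m, gop (gpow tau n) (gpow t2 m) = gop (gpow t2 m) (gpow tau n))
    by (intros; apply Hz; symmetry; now apply gpow_commute).
  rewrite <- !gassoc.
  rewrite (gassoc _ (gpow tau c)), Z1, <- !gassoc.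
  rewrite (gassoc _ (gpow tau c)), Z2, <- !gassoc.
  rewrite (gassoc _ (gpow t2 b)), (gpow_comm_swap t1 t2 tau q) by easy.
  rewrite <- !gassoc.
  rewrite (gassoc _ (gpow tau (- q * b * a'))), Z2, <- !gassoc.
  rewrite (gassoc _ (gpow t1 a)), <- gpow_add. f_equal.
  rewrite (gassoc _ (gpow t2 b)), <- gpow_add. f_equal.
  rewrite <- !gpow_add. f_equal. ring.
Qed.

(** For [n = 1], conjugation by [t3] after [F] and [F] after [heis_aut] are two homomorphisms on
    [heis q], so they need comparing on the three generators only, where the conjugation relations
    and centrality of [tau] say that they agree. Induction on [n] does the rest. *)
Lemma word_conj {A : M2} {G : Grp} {t1 t2 t3 tau : G} {q m1 m2 : Z} (n : Z) (x : heis q) :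
  M2det A = 1 -> pres_rel A q m1 m2 t1 t2 t3 tau ->
  let F := fun x : heis q => let '(a, b, c) := x in word t1 t2 tau a b c in
  gop (gpow t3 n) (F x) = gop (F (heis_act A q m1 m2 n x)) (gpow t3 n).
Proof.
  intros hA (Hc & H1 & H2 & H3 & R1 & R2) F.
  assert (HF : is_hom F) by now apply word_hom.
  assert (Hstep : forall x, gop (gop t3 (F x)) (ginv t3) = F (heis_aut A q m1 m2 x)).
  { apply (@heis_hom_ext q G (fun x => gop (gop t3 (F x)) (ginv t3))
             (fun x => F (heis_aut A q m1 m2 x))).
    - intros y z. now rewrite HF, !gassoc, gopVK.
    - intros y z. now rewrite (heis_aut_hom A q m1 m2 hA), HF.
    - unfold F, heis_aut, M2app, twist, word; cbn [fst snd].
      rewrite gpow_1, !gpow_0, !gid_r, R1. word_ring.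
    - unfold F, heis_aut, M2app, twist, word; cbn [fst snd].
      rewrite gpow_1, !gpow_0, gid_l, gid_r, R2. word_ring.
    - unfold F, heis_aut, M2app, twist, word; cbn [fst snd].
      rewrite !gpow_0, gpow_1, !gid_l, <- H3, gopK.
      transitivity (word t1 t2 tau 0 0 1).
      + unfold word. now rewrite !gpow_0, gpow_1, !gid_l.
      + unfold word. word_ring. }
  assert (Hs : forall y, gop t3 (F y) = gop (F (heis_aut A q m1 m2 y)) t3)
    by (intros y; rewrite <- Hstep; now rewrite gopVK).
  zinduction n; [unfold heis_act; simpl; now rewrite gid_l, gid_r|].
  unfold heis_act in *.
  rewrite ziter_succ by (intros; now apply heis_aut_invK).
  rewrite gpow_succ, gassoc, <- Hs, <- !gassoc.
  split; intros H; [now rewrite H|]. now apply gcancel_l in H.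
Qed.

(** * Normal forms and the universal property of the model *)

Definition model_map {A : M2} {hA : M2det A = 1} {q m1 m2 : Z} {G : Grp}
  (t1 t2 t3 tau : G) (g : model A hA q m1 m2) : G :=
  gop (let '(a, b, c) := fst g in word t1 t2 tau a b c) (gpow t3 (snd g)).

Lemma model_map_hom {A : M2} {hA : M2det A = 1} {q m1 m2 : Z} {G : Grp} (t1 t2 t3 tau : G) :
  pres_rel A q m1 m2 t1 t2 t3 tau ->
  is_hom (@model_map A hA q m1 m2 G t1 t2 t3 tau).
Proof.
  intros HR [x m] [y n]. unfold model_map. cbn [fst snd gop model semidirect].
  pose proof (word_conj m y hA HR) as E. cbv zeta in E.
  destruct HR as (Hc & H1 & H2 & _).
  pose proof (word_hom t1 t2 tau q Hc H1 H2 x (heis_act A q m1 m2 m y)) as E'.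
  cbv beta in E'. rewrite E', gpow_add, <- !gassoc. f_equal.
  rewrite !gassoc. f_equal. now symmetry.
Qed.

Definition model_t1 {A : M2} {hA : M2det A = 1} {q m1 m2 : Z} : model A hA q m1 m2 :=
  ((1, 0, 0), 0).
Definition model_t2 {A : M2} {hA : M2det A = 1} {q m1 m2 : Z} : model A hA q m1 m2 :=
  ((0, 1, 0), 0).
Definition model_t3 {A : M2} {hA : M2det A = 1} {q m1 m2 : Z} : model A hA q m1 m2 :=
  ((0, 0, 0), 1).
Definition model_tau {A : M2} {hA : M2det A = 1} {q m1 m2 : Z} : model A hA q m1 m2 :=
  ((0, 0, 1), 0).

Definition model_incl (A : M2) (hA : M2det A = 1) (q m1 m2 : Z) (x : heis q) :
  model A hA q m1 m2 := (x, 0).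

Lemma model_incl_hom (A : M2) (hA : M2det A = 1) (q m1 m2 : Z) :
  is_hom (model_incl A hA q m1 m2).
Proof. intros x y. reflexivity. Qed.

Lemma model_gpow_t3 (A : M2) (hA : M2det A = 1) (q m1 m2 n : Z) :
  gpow (@model_t3 A hA q m1 m2) n = ((0, 0, 0), n).
Proof.
  symmetry. apply (additive_gpow (fun n => ((0, 0, 0), n) : model A hA q m1 m2)).
  intros a b. cbn [gop model semidirect fst snd].
  rewrite (hom_id _ (heis_act_hom A q m1 m2 hA a) : heis_act A q m1 m2 a (0, 0, 0) = (0, 0, 0)).
  exact (f_equal (fun x : heis q => (x, a + b)) (eq_sym (gid_l (heis q) (0, 0, 0)))).
Qed.

Lemma model_gpow_tau (A : M2) (hA : M2det A = 1) (q m1 m2 n : Z) :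
  gpow (@model_tau A hA q m1 m2) n = ((0, 0, n), 0).
Proof.
  pose proof (hom_gpow (model_incl A hA q m1 m2) (0, 0, 1) n
                (model_incl_hom A hA q m1 m2)) as E.
  rewrite heis_gpow_tau in E. exact (eq_sym E).
Qed.

(** Every element of the model is the normal form of its own coordinates, so the four generators
    generate. Uniqueness of homomorphisms out of the model rests on this. *)
Lemma model_map_id (A : M2) (hA : M2det A = 1) (q m1 m2 : Z) (g : model A hA q m1 m2) :
  model_map model_t1 model_t2 model_t3 model_tau g = g.
Proof.
  destruct g as [[[a b] c] n]. unfold model_map; cbn [fst snd].
  pose proof (hom_word (model_incl A hA q m1 m2) (1, 0, 0) (0, 1, 0) (0, 0, 1) a b c
                (model_incl_hom A hA q m1 m2)) as E.
  rewrite <- heis_word in E. rewrite model_gpow_t3.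
  transitivity (@gop (model A hA q m1 m2) ((a, b, c), 0) ((0, 0, 0), n)).
  - apply (f_equal (fun x => gop x _)). exact (eq_sym E).
  - exact (f_equal (fun x : heis q => (x, n)) (@gid_r (heis q) (a, b, c))).
Qed.

Lemma hom_model_map {A : M2} {hA : M2det A = 1} {q m1 m2 : Z} {G H : Grp} (f : G -> H)
  (t1 t2 t3 tau : G) (g : model A hA q m1 m2) : is_hom f ->
  f (model_map t1 t2 t3 tau g) = model_map (f t1) (f t2) (f t3) (f tau) g.
Proof.
  intros Hf. destruct g as [[[a b] c] n]. unfold model_map; cbn [fst snd].
  now rewrite Hf, (hom_word f), (hom_gpow f) by easy.
Qed.

Lemma model_pres (A : M2) (hA : M2det A = 1) (q m1 m2 : Z) :
  pres_rel A q m1 m2 (@model_t1 A hA q m1 m2) model_t2 model_t3 model_tau.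
Proof.
  assert (Hact : forall n (x : heis q), n = 1 -> heis_act A q m1 m2 n x = heis_aut A q m1 m2 x)
    by (intros n x ->; reflexivity).
  assert (Hw : forall a b c, word (@model_t1 A hA q m1 m2) model_t2 model_tau a b c
                             = ((a, b, c), 0)).
  { intros a b c. transitivity (@gop (model A hA q m1 m2)
      (word model_t1 model_t2 model_tau a b c) (gpow model_t3 0)); [now rewrite gpow_0, gid_r|].
    apply (model_map_id A hA q m1 m2 ((a, b, c), 0)). }
  (* Moving [t3] from left to right past a Heisenberg element applies [heis_aut]. The relations
     involving [t3] follow by evaluating [heis_aut] on generators. *)
  assert (E3 : forall a b c, gop (@model_t3 A hA q m1 m2) ((a, b, c), 0)
               = gop (((heis_aut A q m1 m2 (a, b, c)), 0) : model A hA q m1 m2) model_t3).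
  { intros a b c. unfold model_t3. cbn [gop model semidirect fst snd].
    rewrite Hact by easy.
    exact (f_equal (fun x : heis q => (x, 1))
             (eq_trans (gid_l (heis q) _) (eq_sym (@gid_r (heis q) _)))). }
  split; [|split; [|split; [|split; [|split]]]].
  - apply gcomm_unique. rewrite model_gpow_tau. unfold model_t1, model_t2.
    cbn. pair_ring.
  - unfold model_tau, model_t1.
    cbn [gop model semidirect heis heis_act ziter fst snd]. pair_ring.
  - unfold model_tau, model_t2.
    cbn [gop model semidirect heis heis_act ziter fst snd]. pair_ring.
  - unfold model_tau. rewrite E3. apply (f_equal (fun x => gop x _)).
    unfold heis_aut, M2app, twist; cbn [fst snd]. pair_ring.
  - fold (word (@model_t1 A hA q m1 m2) model_t2 model_tau (m11 A) (m21 A) m1).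
    rewrite Hw. apply (gcancel_r model_t3). rewrite gopVK. unfold model_t1.
    rewrite E3. apply (f_equal (fun x => gop x _)).
    unfold heis_aut, M2app, twist; cbn [fst snd]. pair_ring.
  - fold (word (@model_t1 A hA q m1 m2) model_t2 model_tau (m12 A) (m22 A) m2).
    rewrite Hw. apply (gcancel_r model_t3). rewrite gopVK. unfold model_t2.
    rewrite E3. apply (f_equal (fun x => gop x _)).
    unfold heis_aut, M2app, twist; cbn [fst snd]. pair_ring.
Qed.

Lemma model_presented (A : M2) (hA : M2det A = 1) (q m1 m2 : Z) :
  is_presented A q m1 m2 (model A hA q m1 m2) model_t1 model_t2 model_t3 model_tau.
Proof.
  split; [apply model_pres|]. intros H a1 a2 a3 b HR. split.
  - exists (model_map a1 a2 a3 b). split; [now apply model_map_hom|].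
    unfold model_map, model_t1, model_t2, model_t3, model_tau, word; cbn [fst snd].
    rewrite !gpow_1. cbn. now rewrite !gid_l, !gid_r.
  - intros f g Hf Hg E1 E2 E3 E4 x. rewrite <- (model_map_id A hA q m1 m2 x).
    rewrite (hom_model_map f), (hom_model_map g) by easy. now rewrite E1, E2, E3, E4.
Qed.

Lemma model_ext (A : M2) (hA : M2det A = 1) (q m1 m2 : Z) :
  is_central_ext A (model A hA q m1 m2) (gpow model_tau) (model_pi A hA q m1 m2).
Proof.
  split; [|split; [|split; [|split; [|split]]]].
  - intros a b. apply gpow_add.
  - intros a b. rewrite !model_gpow_tau. now intros [= E].
  - intros n g. apply gpow_commute. destruct (model_pres A hA q m1 m2) as (_ & H1 & H2 & H3 & _).
    rewrite <- (model_map_id A hA q m1 m2 g). destruct g as [[[a b] c] m].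
    unfold model_map, word; cbn [fst snd].
    assert (Hz : forall t m, gop model_tau t = gop t (@model_tau A hA q m1 m2) ->
              gop model_tau (gpow t m) = gop (gpow t m) model_tau)
      by (intros; symmetry; now apply gpow_commute).
    rewrite !gassoc, Hz, <- !gassoc by easy. f_equal.
    rewrite !gassoc, Hz, <- !gassoc by easy. f_equal.
    rewrite !gassoc, Hz, <- !gassoc by easy. f_equal. now apply Hz.
  - intros [x m] [y n]. unfold model_pi. cbn [gop model semidirect fst snd].
    rewrite GammaS_mul_eq, <- heis_act_fst with (q := q) (m1 := m1) (m2 := m2) by easy.
    destruct (heis_act A q m1 m2 m y) as [[a' b'] c']. destruct x as [[a b] c]. reflexivity.
  - intros [v n]. exists ((v, 0), n). reflexivity.
  - intros [[v c] n]. unfold model_pi, GammaS_id; cbn [fst snd]. split.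
    + intros [= -> ->]. exists c. now rewrite model_gpow_tau.
    + intros [k Hk]. rewrite model_gpow_tau in Hk. now injection Hk as -> _ ->.
Qed.

(** * Classification of central extensions *)

Definition is_lift {G : Grp} (pi : G -> (Z * Z) * Z) (t1 t2 t3 : G) : Prop :=
  pi t1 = ((1, 0), 0) /\ pi t2 = ((0, 1), 0) /\ pi t3 = ((0, 0), 1).

Lemma conj_eq {G : Grp} (x y w : G) :
  gop (gop x y) (ginv x) = w <-> gop x y = gop w x.
Proof.
  split; intros H; [now rewrite <- H, gopVK|]. now rewrite H, gopK.
Qed.

Lemma hom_pres_rel {A : M2} {q m1 m2 : Z} {G H : Grp} (f : G -> H) (t1 t2 t3 tau : G) :
  is_hom f -> pres_rel A q m1 m2 t1 t2 t3 tau ->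
  pres_rel A q m1 m2 (f t1) (f t2) (f t3) (f tau).
Proof.
  intros Hf (Hc & H1 & H2 & H3 & R1 & R2).
  unfold pres_rel. rewrite <- !(hom_gpow f), <- !(hom_inv f) by easy.
  rewrite <- !Hf, <- (hom_comm f), Hc, H1, H2, H3, R1, R2 by easy. easy.
Qed.

Lemma central_swap {G : Grp} (x y z w : G) : gop z y = gop y z ->
  gop (gop x z) (gop y w) = gop (gop x y) (gop z w).
Proof. intros H. now rewrite !gassoc, <- (gassoc _ x), H, gassoc. Qed.

(** Central factors drop out of the commutator, and the factor on [t3] drops out of conjugation by
    [t3]. Conjugating the shifted [t1] gains [tau^a] on the left side and [tau^(s11 a + s21 b)] on
    the right, so [m1] moves by the first entry of the row vector [(a, b)(S - I)]; [t2] gives the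
    second entry. *)
Lemma pres_shift {A : M2} {q m1 m2 m1' m2' : Z} {G : Grp} {t1 t2 t3 tau : G} (a b c : Z) :
  (forall x, gop tau x = gop x tau) ->
  m1 - m1' = (m11 A - 1) * a + m21 A * b ->
  m2 - m2' = m12 A * a + (m22 A - 1) * b ->
  pres_rel A q m1 m2 t1 t2 t3 tau ->
  pres_rel A q m1' m2' (gop t1 (gpow tau a)) (gop t2 (gpow tau b))
    (gop t3 (gpow tau c)) tau.
Proof.
  intros Hz E1 E2 (Hc & _ & _ & _ & R1 & R2).
  assert (Hzn : forall n x, gop (gpow tau n) x = gop x (gpow tau n))
    by (intros; now apply gpow_commute).
  (* One computation for both conjugation relations: [t] is [t1] with [d = a], then [t2] with
     [d = b]. *)
  assert (Hconj : forall t s s' d m m', m + d = a * s + b * s' + m' ->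
    gop (gop t3 t) (ginv t3) = gop (gop (gpow t1 s) (gpow t2 s')) (gpow tau m) ->
    gop (gop (gop t3 (gpow tau c)) (gop t (gpow tau d))) (ginv (gop t3 (gpow tau c))) =
    gop (gop (gpow (gop t1 (gpow tau a)) s) (gpow (gop t2 (gpow tau b)) s'))
        (gpow tau m')).
  { intros t s s' d m m' Em Ht. apply conj_eq. apply conj_eq in Ht.
    rewrite !gpow_mul_central, !gpow_gpow by auto.
    rewrite (central_swap t3 t), (central_swap (gpow t1 s) (gpow t2 s')) by auto.
    rewrite Ht. set (W := gop (gpow t1 s) (gpow t2 s')).
    rewrite <- !gpow_add, <- !(gassoc _ W), (Hzn m t3), <- gpow_add.
    rewrite !(gassoc _ W), (central_swap W t3) by auto.
    rewrite <- gpow_add, <- !gassoc, <- gpow_add. do 3 f_equal. lia. }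
  split; [|split; [|split; [|split; [|split]]]]; auto.
  - apply gcomm_unique. rewrite (central_swap t1 t2), (central_swap t2 t1), <- Hc by auto.
    rewrite gassoc, gcomm_mul. f_equal. auto.
  - apply Hconj with m1; [lia|easy].
  - apply Hconj with m2; [lia|easy].
Qed.

(** For fixed lifts the exponents can be read off, since [tau] has infinite order. *)
Lemma pres_rel_inj {A : M2} {q m1 m2 q' m1' m2' : Z} {G : Grp} {t1 t2 t3 tau : G} :
  (forall a b, gpow tau a = gpow tau b -> a = b) ->
  pres_rel A q m1 m2 t1 t2 t3 tau -> pres_rel A q' m1' m2' t1 t2 t3 tau ->
  q = q' /\ m1 = m1' /\ m2 = m2'.
Proof.
  intros Hi (Hc & _ & _ & _ & R1 & R2) (Hc' & _ & _ & _ & R1' & R2').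
  rewrite Hc in Hc'. rewrite R1 in R1'. rewrite R2 in R2'.
  apply gcancel_l in R1', R2'. auto.
Qed.

Lemma ext_hom {A : M2} (hA : M2det A = 1) {G : Grp} {iota : Z -> G}
  {pi : G -> (Z * Z) * Z} : is_central_ext A G iota pi ->
  is_hom (pi : G -> GammaS_grp A hA).
Proof. intros (_ & _ & _ & H & _). exact H. Qed.

Lemma ext_iota {A : M2} {G : Grp} {iota : Z -> G} {pi : G -> (Z * Z) * Z} (n : Z) :
  is_central_ext A G iota pi -> iota n = gpow (iota 1) n.
Proof. intros (H & _). now apply additive_gpow. Qed.

Lemma ext_gpow_inj {A : M2} {G : Grp} {iota : Z -> G} {pi : G -> (Z * Z) * Z} (a b : Z) :
  is_central_ext A G iota pi -> gpow (iota 1) a = gpow (iota 1) b -> a = b.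
Proof. intros H. rewrite <- !(ext_iota _ H). apply H. Qed.

Lemma ext_fiber {A : M2} (hA : M2det A = 1) {G : Grp} {iota : Z -> G}
  {pi : G -> (Z * Z) * Z} (g h : G) : is_central_ext A G iota pi ->
  pi g = pi h -> exists n, g = gop h (gpow (iota 1) n).
Proof.
  intros HE Hgh. pose proof (ext_hom hA HE) as Hpi.
  assert (Hk : pi (gop (ginv h) g) = GammaS_id).
  { change (pi (gop (ginv h) g) = @gid (GammaS_grp A hA)).
    rewrite Hpi, (hom_inv (pi : G -> GammaS_grp A hA)) by easy. rewrite Hgh. apply (ginv_l (GammaS_grp A hA)). }
  apply HE in Hk. destruct Hk as [n Hn]. exists n.
  rewrite <- (ext_iota _ HE), <- Hn, gassoc, ginv_r. now rewrite gid_l.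
Qed.

Lemma ext_pi_tau {A : M2} {G : Grp} {iota : Z -> G} {pi : G -> (Z * Z) * Z} (c : Z) :
  is_central_ext A G iota pi -> pi (gpow (iota 1) c) = GammaS_id.
Proof. intros HE. apply HE. exists c. symmetry. exact (ext_iota _ HE). Qed.

Lemma GammaS_mul_id_r (A : M2) (hA : M2det A = 1) (x : (Z * Z) * Z) :
  GammaS_mul A x GammaS_id = x.
Proof. exact (@gid_r (GammaS_grp A hA) x). Qed.

Lemma GammaS_gpow_e1 (A : M2) (hA : M2det A = 1) (a : Z) :
  @gpow (GammaS_grp A hA) ((1, 0), 0) a = ((a, 0), 0).
Proof.
  symmetry. apply (additive_gpow (fun a => ((a, 0), 0) : GammaS_grp A hA)).
  intros x y. cbn [gop GammaS_grp]. rewrite GammaS_mul_eq. cbn [M2pow].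
  now rewrite M2app_id.
Qed.

Lemma GammaS_gpow_e2 (A : M2) (hA : M2det A = 1) (b : Z) :
  @gpow (GammaS_grp A hA) ((0, 1), 0) b = ((0, b), 0).
Proof.
  symmetry. apply (additive_gpow (fun b => ((0, b), 0) : GammaS_grp A hA)).
  intros x y. cbn [gop GammaS_grp]. rewrite GammaS_mul_eq. cbn [M2pow].
  now rewrite M2app_id.
Qed.

Lemma GammaS_gpow_e3 (A : M2) (hA : M2det A = 1) (n : Z) :
  @gpow (GammaS_grp A hA) ((0, 0), 1) n = ((0, 0), n).
Proof.
  symmetry. apply (additive_gpow (fun n => ((0, 0), n) : GammaS_grp A hA)).
  intros x y. cbn [gop GammaS_grp]. rewrite GammaS_mul_eq. now rewrite M2app_zero.
Qed.

Lemma pi_t1t2t3 {A : M2} (hA : M2det A = 1) {G : Grp} {iota : Z -> G}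
  {pi : G -> (Z * Z) * Z} {t1 t2 t3 : G} (a b n : Z) :
  is_central_ext A G iota pi -> is_lift pi t1 t2 t3 ->
  pi (gop (gop (gpow t1 a) (gpow t2 b)) (gpow t3 n)) = ((a, b), n).
Proof.
  intros HE (E1 & E2 & E3). pose proof (ext_hom hA HE) as Hpi.
  rewrite !Hpi, !(hom_gpow (pi : G -> GammaS_grp A hA)) by easy.
  rewrite E1, E2, E3, GammaS_gpow_e1, GammaS_gpow_e2, GammaS_gpow_e3.
  cbn [gop GammaS_grp]. rewrite !GammaS_mul_eq, M2app_zero. cbn [M2pow].
  rewrite M2app_id. unfold vadd; cbn [fst snd]. now rewrite !Z.add_0_r.
Qed.

Lemma pi_model_map {A : M2} {hA : M2det A = 1} {q m1 m2 : Z} {G : Grp} {iota : Z -> G}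
  {pi : G -> (Z * Z) * Z} {t1 t2 t3 : G} (x : model A hA q m1 m2) :
  is_central_ext A G iota pi -> is_lift pi t1 t2 t3 ->
  pi (model_map t1 t2 t3 (iota 1) x) = model_pi A hA q m1 m2 x.
Proof.
  intros HE Ht. destruct x as [[[a b] c] n]. unfold model_map, model_pi, word; cbn [fst snd].
  rewrite <- gassoc, (gpow_commute (iota 1)) by apply HE. rewrite gassoc.
  rewrite (ext_hom hA HE). cbn [gop GammaS_grp].
  now rewrite (ext_pi_tau c HE), GammaS_mul_id_r, (pi_t1t2t3 hA a b n HE Ht).
Qed.

(** A five lemma done by hand, together with [model_map_surj]: [pi] determines the coordinates [a],
    [b], [n], and the fibre over them is a coset of the infinite cyclic group generated by [iota 1],
    which accounts for [c]. *)
Lemma model_map_inj {A : M2} {hA : M2det A = 1} {q m1 m2 : Z} {G : Grp} {iota : Z -> G}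
  {pi : G -> (Z * Z) * Z} {t1 t2 t3 : G} (x y : model A hA q m1 m2) :
  is_central_ext A G iota pi -> is_lift pi t1 t2 t3 ->
  model_map t1 t2 t3 (iota 1) x = model_map t1 t2 t3 (iota 1) y -> x = y.
Proof.
  intros HE Ht E. pose proof (f_equal pi E) as Ep.
  rewrite !(pi_model_map _ HE Ht) in Ep.
  destruct x as [[v c] n], y as [[w d] m]. unfold model_pi in Ep; cbn [fst snd] in Ep.
  injection Ep as -> ->. unfold model_map in E; cbn [fst snd] in E.
  destruct w as [a b]. apply gcancel_r, gcancel_l, (ext_gpow_inj _ _ HE) in E.
  now rewrite E.
Qed.

Lemma model_map_surj {A : M2} (hA : M2det A = 1) (q m1 m2 : Z) {G : Grp} {iota : Z -> G}
  {pi : G -> (Z * Z) * Z} {t1 t2 t3 : G} (g : G) :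
  is_central_ext A G iota pi -> is_lift pi t1 t2 t3 ->
  exists x : model A hA q m1 m2, model_map t1 t2 t3 (iota 1) x = g.
Proof.
  intros HE Ht. destruct (pi g) as [[a b] n] eqn:E.
  destruct (ext_fiber hA g _ HE (eq_trans E (eq_sym (pi_t1t2t3 hA a b n HE Ht)))) as [c ->].
  exists ((a, b, c), n). unfold model_map, word; cbn [fst snd].
  rewrite <- gassoc, (gpow_commute (iota 1)) by apply HE. now rewrite gassoc.
Qed.

(** A relation rather than a function, because the vector depends on the lifts chosen;
    [has_inv_shift] and [has_inv_unique] show that it ranges over exactly one class of
    [coker_eq]. *)
Definition has_inv {A : M2} (E : CExt A) (q : Z) (v : Z * Z) : Prop :=
  exists t1 t2 t3, is_lift (cx_pi E) t1 t2 t3 /\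
    pres_rel A q (fst v) (snd v) t1 t2 t3 (cx_iota E 1).

(** The two sides of each relation, without the power of [tau], have equal images under [pi]; by
    exactness they differ by a power of [iota 1], and that exponent is the invariant. *)
Lemma has_inv_exists {A : M2} (hA : M2det A = 1) (E : CExt A) :
  exists qv : Z * (Z * Z), has_inv E (fst qv) (snd qv).
Proof.
  destruct E as [G iota pi HE].
  assert (Hsurj : forall c, exists g, pi g = c) by apply HE.
  destruct (Hsurj ((1, 0), 0)) as [t1 E1]. destruct (Hsurj ((0, 1), 0)) as [t2 E2].
  destruct (Hsurj ((0, 0), 1)) as [t3 E3].
  assert (Ht : is_lift pi t1 t2 t3) by easy.
  pose proof (ext_hom hA HE) as Hpi.
  assert (Hz : forall n x, gop (gpow (iota 1) n) x = gop x (gpow (iota 1) n))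
    by (intros; apply gpow_commute; apply HE).
  assert (Hcomm : exists q, gcomm t1 t2 = gpow (iota 1) q).
  { destruct (ext_fiber hA (gop t1 t2) (gop t2 t1) HE) as [q Hq].
    - rewrite !Hpi, E1, E2. reflexivity.
    - exists q. apply gcomm_unique. now rewrite Hz. }
  assert (Hconj : forall t a b, pi (gop t3 t) = ((a, b), 1) ->
            exists m, gop (gop t3 t) (ginv t3) =
                      gop (gop (gpow t1 a) (gpow t2 b)) (gpow (iota 1) m)).
  { intros t a b Hab. destruct (ext_fiber hA _ _ HE
      (eq_trans Hab (eq_sym (pi_t1t2t3 hA a b 1 HE Ht)))) as [m Hm].
    exists m. apply conj_eq. rewrite Hm, gpow_1, <- !gassoc. now rewrite Hz. }
  destruct Hcomm as [q Hq].
  destruct (Hconj t1 (m11 A) (m21 A)) as [m1 Hm1].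
  { rewrite Hpi, E1, E3. cbn [gop GammaS_grp]. rewrite GammaS_mul_eq, M2app_pow.
    change (ziter _ _ 1 (1, 0)) with (M2app A (1, 0)).
    unfold vadd, M2app; cbn [fst snd]. pair_ring. }
  destruct (Hconj t2 (m12 A) (m22 A)) as [m2 Hm2].
  { rewrite Hpi, E2, E3. cbn [gop GammaS_grp]. rewrite GammaS_mul_eq, M2app_pow.
    change (ziter _ _ 1 (0, 1)) with (M2app A (0, 1)).
    unfold vadd, M2app; cbn [fst snd]. pair_ring. }
  exists (q, (m1, m2)), t1, t2, t3. split; [easy|].
  repeat split; cbn [cx_iota cx_grp fst snd]; auto; apply HE.
Qed.

Lemma has_inv_shift {A : M2} (E : CExt A) (q : Z) (v w : Z * Z) :
  coker_eq A v w -> has_inv E q v -> has_inv E q w.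
Proof.
  destruct E as [G iota pi HE].
  intros (a & b & Ea & Eb) (t1 & t2 & t3 & (E1 & E2 & E3) & HR).
  cbn [cx_pi cx_iota cx_grp] in *.
  assert (HEpi : forall x n, pi (gop x (gpow (iota 1) n)) = pi x).
  { intros x n. assert (Hpi : forall g h, pi (gop g h) = GammaS_mul A (pi g) (pi h))
      by apply HE.
    rewrite Hpi, (ext_pi_tau n HE). unfold GammaS_id.
    destruct (pi x) as [[y z] k]. rewrite GammaS_mul_eq, M2app_zero.
    unfold vadd; cbn [fst snd]. now rewrite !Z.add_0_r. }
  exists (gop t1 (gpow (iota 1) a)), (gop t2 (gpow (iota 1) b)), (gop t3 (gpow (iota 1) 0)).
  split; [unfold is_lift; now rewrite !HEpi|].
  apply (pres_shift (m1 := fst v) (m2 := snd v)); auto. apply HE.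
Qed.

(** Two systems of lifts differ by central powers [a], [b], [c]. [pres_shift] carries the first set
    of relations over to the second system, where [pres_rel_inj] compares exponents. *)
Lemma has_inv_unique {A : M2} (hA : M2det A = 1) (E : CExt A) (q q' : Z) (v w : Z * Z) :
  has_inv E q v -> has_inv E q' w -> q = q' /\ coker_eq A v w.
Proof.
  destruct E as [G iota pi HE].
  intros (t1 & t2 & t3 & (E1 & E2 & E3) & HR) (t1' & t2' & t3' & (E1' & E2' & E3') & HR').
  cbn [cx_pi cx_iota cx_grp] in *.
  destruct (ext_fiber hA t1' t1 HE) as [a ->]; [congruence|].
  destruct (ext_fiber hA t2' t2 HE) as [b ->]; [congruence|].
  destruct (ext_fiber hA t3' t3 HE) as [c ->]; [congruence|].
  destruct v as [m1 m2], w as [m1' m2']. cbn [fst snd] in *.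
  apply (pres_shift (m1' := m1 - ((m11 A - 1) * a + m21 A * b))
           (m2' := m2 - (m12 A * a + (m22 A - 1) * b)) a b c) in HR; [|apply HE|ring|ring].
  destruct (pres_rel_inj (fun x y => ext_gpow_inj x y HE) HR HR') as (-> & E4 & E5).
  split; [easy|]. exists a, b. cbn [fst snd]. lia.
Qed.

(** Both extensions are bijective images of the same model, under [f1] and [f2]. The equivalence is
    [f2] after the inverse of [f1], the latter obtained by choosing preimages. *)
Lemma has_inv_equiv {A : M2} (hA : M2det A = 1) (E1 E2 : CExt A) (q : Z) (v : Z * Z) :
  has_inv E1 q v -> has_inv E2 q v -> ext_equiv E1 E2.
Proof.
  destruct E1 as [G1 iota1 pi1 HE1], E2 as [G2 iota2 pi2 HE2].
  intros (t1 & t2 & t3 & Ht & HR) (s1 & s2 & s3 & Hs & HR').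
  destruct v as [m1 m2]. unfold ext_equiv. cbn [cx_pi cx_iota cx_grp fst snd] in *.
  set (f1 := @model_map A hA q m1 m2 G1 t1 t2 t3 (iota1 1)).
  set (f2 := @model_map A hA q m1 m2 G2 s1 s2 s3 (iota2 1)).
  assert (Hf1 : is_hom f1) by now apply model_map_hom.
  assert (Hf2 : is_hom f2) by now apply model_map_hom.
  pose (lft := fun g => constructive_indefinite_description _
                 (model_map_surj hA q m1 m2 g HE1 Ht)).
  assert (Hlft : forall g, f1 (proj1_sig (lft g)) = g) by (intros g; exact (proj2_sig (lft g))).
  assert (Hinj : forall x y, f1 x = f1 y -> x = y)
    by (intros x y; now apply (model_map_inj (pi := pi1))).
  exists (fun g => f2 (proj1_sig (lft g))). split; [|split].
  - intros g h. rewrite <- Hf2. f_equal. apply Hinj. now rewrite Hf1, !Hlft.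
  - intros n.
    assert (Hn : proj1_sig (lft (iota1 n)) = ((0, 0, n), 0)).
    { apply Hinj. rewrite Hlft, (ext_iota n HE1). unfold f1, model_map, word; cbn [fst snd].
      now rewrite !gpow_0, !gid_l, gid_r. }
    rewrite Hn, (ext_iota n HE2). unfold f2, model_map, word; cbn [fst snd].
    now rewrite !gpow_0, !gid_l, gid_r.
  - intros g. rewrite <- (Hlft g) at 2. unfold f1, f2.
    now rewrite (pi_model_map _ HE1 Ht), (pi_model_map _ HE2 Hs).
Qed.

Lemma has_inv_transport {A : M2} (E1 E2 : CExt A) (q : Z) (v : Z * Z) :
  ext_equiv E1 E2 -> has_inv E1 q v -> has_inv E2 q v.
Proof.
  intros (f & Hf & Hi & Hp) (t1 & t2 & t3 & (H1 & H2 & H3) & HR).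
  exists (f t1), (f t2), (f t3). split; [unfold is_lift; now rewrite !Hp|].
  rewrite <- Hi. now apply hom_pres_rel.
Qed.

(** The universal properties of [P] and of the model give mutually inverse homomorphisms [f] and
    [F]; the extension structure of the model is then pulled back along [f]. *)
Lemma presented_ext {A : M2} (hA : M2det A = 1) {q m1 m2 : Z} {P : Grp} {t1 t2 t3 tau : P} :
  is_presented A q m1 m2 P t1 t2 t3 tau ->
  exists pi : P -> (Z * Z) * Z,
    is_central_ext A P (gpow tau) pi /\ is_lift pi t1 t2 t3.
Proof.
  intros [HR HP].
  destruct (proj1 (HP _ _ _ _ _ (model_pres A hA q m1 m2)))
    as (f & Hf & F1 & F2 & F3 & F4).
  set (F := @model_map A hA q m1 m2 P t1 t2 t3 tau).
  assert (HF : is_hom F) by now apply model_map_hom.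
  assert (FK : forall x, f (F x) = x).
  { intros x. unfold F. rewrite (hom_model_map f), F1, F2, F3, F4 by easy.
    apply model_map_id. }
  (* The uniqueness clause is applied with [P] itself as target: [F] after [f] and the identity
     agree on the generators. *)
  assert (fK : forall g, F (f g) = g).
  { intros g. destruct (HP P t1 t2 t3 tau HR) as [_ Huniq].
    apply (Huniq (fun g => F (f g)) (fun g => g)); try easy.
    - intros x y. now rewrite Hf, HF.
    - rewrite F1. unfold F, model_map, model_t1, word; cbn [fst snd].
      now rewrite !gpow_0, gpow_1, !gid_r.
    - rewrite F2. unfold F, model_map, model_t2, word; cbn [fst snd].
      now rewrite !gpow_0, gpow_1, !gid_r, gid_l.
    - rewrite F3. unfold F, model_map, model_t3, word; cbn [fst snd].
      now rewrite !gpow_0, gpow_1, !gid_l.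
    - rewrite F4. unfold F, model_map, model_tau, word; cbn [fst snd].
      now rewrite !gpow_0, gpow_1, !gid_l, gid_r. }
  destruct (model_ext A hA q m1 m2) as (_ & Hinj & Hcen & Hpi & Hsurj & Hker).
  exists (fun g => model_pi A hA q m1 m2 (f g)). split.
  - split; [|split; [|split; [|split; [|split]]]].
    + apply gpow_add.
    + intros a b E. apply (f_equal f) in E. rewrite !(hom_gpow f), F4 in E by easy. auto.
    + intros n g. rewrite <- (fK (gop _ g)), <- (fK (gop g _)). f_equal.
      now rewrite !Hf, (hom_gpow f), F4 by easy.
    + intros g h. now rewrite Hf, Hpi.
    + intros c. destruct (Hsurj c) as [x Hx]. exists (F x). now rewrite FK.
    + intros g. rewrite Hker. split; intros [n Hn]; exists n.
      * rewrite <- (fK g), Hn, <- F4, <- (hom_gpow f) by easy. apply fK.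
      * now rewrite Hn, (hom_gpow f), F4.
  - unfold is_lift. now rewrite F1, F2, F3.
Qed.

(** * Solvability and the nilradical *)

Lemma ext_snd {A : M2} {G : Grp} {iota : Z -> G} {pi : G -> (Z * Z) * Z} (g h : G) :
  is_central_ext A G iota pi -> snd (pi (gop g h)) = snd (pi g) + snd (pi h).
Proof.
  intros (_ & _ & _ & H & _). rewrite H.
  destruct (pi g) as [v m], (pi h) as [w n]. reflexivity.
Qed.

Lemma ext_snd_inv {A : M2} (hA : M2det A = 1) {G : Grp} {iota : Z -> G}
  {pi : G -> (Z * Z) * Z} (g : G) :
  is_central_ext A G iota pi -> snd (pi (ginv g)) = - snd (pi g).
Proof.
  intros HE. rewrite (hom_inv (pi : G -> GammaS_grp A hA)) by now apply (ext_hom hA HE).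
  reflexivity.
Qed.

Lemma ext_snd_id {A : M2} (hA : M2det A = 1) {G : Grp} {iota : Z -> G}
  {pi : G -> (Z * Z) * Z} : is_central_ext A G iota pi -> snd (pi gid) = 0.
Proof.
  intros HE. rewrite (hom_id (pi : G -> GammaS_grp A hA)) by now apply (ext_hom hA HE).
  reflexivity.
Qed.

Lemma ext_snd_gcomm {A : M2} (hA : M2det A = 1) {G : Grp} {iota : Z -> G}
  {pi : G -> (Z * Z) * Z} (g h : G) :
  is_central_ext A G iota pi -> snd (pi (gcomm g h)) = 0.
Proof.
  intros HE. unfold gcomm. rewrite !(ext_snd _ _ HE), !(ext_snd_inv hA _ HE). ring.
Qed.

(** So [[x, y]] projects to [(S^n - I) v]. Comparing images in [[x, y] y x = x y] cancels the
    translation part of [x] and avoids inverses in the semidirect product. *)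
Lemma ext_fst_gcomm {A : M2} (hA : M2det A = 1) {G : Grp} {iota : Z -> G}
  {pi : G -> (Z * Z) * Z} (x y : G) :
  is_central_ext A G iota pi -> snd (pi y) = 0 ->
  vadd (fst (pi (gcomm x y))) (fst (pi y)) = M2app (M2pow A (snd (pi x))) (fst (pi y)).
Proof.
  intros HE Hy. pose proof (f_equal pi (gcomm_mul x y)) as E.
  pose proof (ext_snd_gcomm hA x y HE) as Hc.
  rewrite !(ext_hom hA HE) in E. cbn [gop GammaS_grp] in E.
  destruct (pi (gcomm x y)) as [u k], (pi x) as [w n], (pi y) as [v m].
  cbn [fst snd] in *. subst k m. rewrite !GammaS_mul_eq in E. cbn [M2pow] in E.
  rewrite !M2app_id in E. apply (f_equal fst) in E. cbn [fst] in E.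
  destruct (M2app (M2pow A n) v) as [p r]. destruct u, v, w. unfold vadd in *; cbn [fst snd] in *.
  injection E as Ea Eb. f_equal; lia.
Qed.

Lemma ext_gcomm_ker {A : M2} (hA : M2det A = 1) {G : Grp} {iota : Z -> G}
  {pi : G -> (Z * Z) * Z} (x y : G) :
  is_central_ext A G iota pi -> snd (pi x) = 0 -> snd (pi y) = 0 ->
  pi (gcomm x y) = GammaS_id.
Proof.
  intros HE Hx Hy. pose proof (ext_fst_gcomm hA x y HE Hy) as E.
  pose proof (ext_snd_gcomm hA x y HE) as Hc. rewrite Hx in E. cbn [M2pow] in E.
  rewrite M2app_id in E. unfold GammaS_id.
  destruct (pi (gcomm x y)) as [[a b] k], (pi y) as [[c d] l]. unfold vadd in E.
  cbn [fst snd] in *. injection E as Ea Eb. repeat f_equal; lia.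
Qed.

Lemma ext_ker_subgroup {A : M2} (hA : M2det A = 1) {G : Grp} {iota : Z -> G}
  {pi : G -> (Z * Z) * Z} : is_central_ext A G iota pi ->
  is_subgroup (fun x => pi x = GammaS_id).
Proof.
  intros HE. pose proof (ext_hom hA HE) as Hpi.
  change (is_subgroup (fun x : G => (pi : G -> GammaS_grp A hA) x = gid)).
  repeat split.
  - now apply (hom_id (pi : G -> GammaS_grp A hA)).
  - intros x y Hx Hy. rewrite Hpi, Hx, Hy. apply (gid_l (GammaS_grp A hA)).
  - intros x Hx. rewrite (hom_inv (pi : G -> GammaS_grp A hA)), Hx by easy. apply (@ginv_id (GammaS_grp A hA)).
Qed.

Lemma trivial_subgroup (G : Grp) : is_subgroup (fun x : G => x = gid).
Proof.
  repeat split.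
  - intros x y -> ->. apply gid_l.
  - intros x ->. apply ginv_id.
Qed.

Lemma ext_snd_subgroup {A : M2} (hA : M2det A = 1) {G : Grp} {iota : Z -> G}
  {pi : G -> (Z * Z) * Z} : is_central_ext A G iota pi ->
  is_subgroup (fun x => snd (pi x) = 0).
Proof.
  intros HE. repeat split.
  - apply (ext_snd_id hA HE).
  - intros x y Hx Hy. rewrite (ext_snd _ _ HE). lia.
  - intros x Hx. rewrite (ext_snd_inv hA _ HE). lia.
Qed.

Lemma ext_gcomm_central {A : M2} {G : Grp} {iota : Z -> G}
  {pi : G -> (Z * Z) * Z} (x y : G) :
  is_central_ext A G iota pi -> pi y = GammaS_id -> gcomm x y = gid.
Proof.
  intros HE Hy. apply HE in Hy. destruct Hy as [n ->].
  apply gcomm_eq_id. symmetry. apply HE.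
Qed.

(** The derived series descends to the kernel of the projection to [Z], then to the central [Z],
    then to the trivial group, since the successive quotients [Z], [Z^2], [Z] are abelian. *)
Lemma ext_solvable {A : M2} (hA : M2det A = 1) {G : Grp} {iota : Z -> G}
  {pi : G -> (Z * Z) * Z} : is_central_ext A G iota pi -> solvable G.
Proof.
  intros HE. exists 3%nat.
  assert (D1 : forall x, derived G 1 x -> snd (pi x) = 0).
  { apply commsub_incl; [now apply (ext_snd_subgroup hA HE)|].
    intros k l _ _. apply (ext_snd_gcomm hA _ _ HE). }
  assert (D2 : forall x, derived G 2 x -> pi x = GammaS_id).
  { apply commsub_incl; [now apply (ext_ker_subgroup hA HE)|].
    intros k l Hk Hl. apply (ext_gcomm_ker hA _ _ HE); now apply D1. }
  apply commsub_incl; [apply trivial_subgroup|].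
  intros k l _ Hl. apply (ext_gcomm_central _ _ HE). now apply D2.
Qed.

(** Identifies the subgroup generated by [t1], [t2], [tau] with the kernel of the projection to [Z],
    a form in which normality and nilpotency are immediate. *)
Lemma gen_lifts_iff {A : M2} (hA : M2det A = 1) {G : Grp} {tau : G}
  {pi : G -> (Z * Z) * Z} {t1 t2 t3 : G} (x : G) :
  is_central_ext A G (gpow tau) pi -> is_lift pi t1 t2 t3 ->
  gen (fun x => x = t1 \/ x = t2 \/ x = tau) x <-> snd (pi x) = 0.
Proof.
  intros HE Ht. split.
  - intros Hx. apply Hx; [now apply (ext_snd_subgroup hA HE)|].
    destruct Ht as (E1 & E2 & _).
    intros y [->|[->| ->]]; [now rewrite E1|now rewrite E2|].
    pose proof (ext_pi_tau 1 HE) as E. rewrite !gpow_1 in E. now rewrite E.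
  - intros Hx. destruct (pi x) as [[a b] n] eqn:E. cbn [snd] in Hx. subst n.
    destruct (ext_fiber hA x _ HE (eq_trans E (eq_sym (pi_t1t2t3 hA a b 0 HE Ht)))) as [c ->].
    rewrite !gpow_1, gpow_0, gid_r.
    pose proof (gen_subgroup (fun x => x = t1 \/ x = t2 \/ x = tau)) as HK.
    apply HK; [apply HK|]; apply subgroup_gpow; try exact HK; intros K _ HKg; apply HKg; auto.
Qed.

(* A normal nilpotent subgroup containing [x] with [snd (pi x) = n <> 0] contains the
   iterated commutators of [x] with [t1]; these project to [(S^n - I)^k] applied to a
   nonzero vector, which never vanishes. *)
Lemma ext_nilradical {A : M2} (hA : M2det A = 1) (htr : m11 A + m22 A > 2)
  {G : Grp} {tau : G} {pi : G -> (Z * Z) * Z} {t1 t2 t3 : G} :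
  is_central_ext A G (gpow tau) pi -> is_lift pi t1 t2 t3 ->
  is_nilradical (gen (fun x => x = t1 \/ x = t2 \/ x = tau)).
Proof.
  intros HE Ht. set (N := gen _).
  assert (HN : forall x, N x <-> snd (pi x) = 0)
    by (intros x; now apply (gen_lifts_iff hA x HE Ht)).
  split; [split; [apply gen_subgroup|]|split].
  - intros g x. rewrite !HN. intros Hx.
    rewrite !(ext_snd _ _ HE), (ext_snd_inv hA _ HE). lia.
  - exists 2%nat.
    (* [N] modulo the central [Z] is the abelian group [Z^2], so [N] has class at most 2. *)
    assert (D1 : forall x, lcs N 1 x -> pi x = GammaS_id).
    { apply commsub_incl; [now apply (ext_ker_subgroup hA HE)|].
      intros k l Hk Hl. apply (ext_gcomm_ker hA _ _ HE); now apply HN. }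
    apply commsub_incl; [apply trivial_subgroup|].
    intros k l _ Hl. apply (ext_gcomm_central _ _ HE). now apply D1.
  - intros M [HM Hnorm] [k Hk] x Hx. apply HN.
    destruct (Z.eq_dec (snd (pi x)) 0) as [|Hn]; [easy|exfalso].
    assert (Hstep : forall y, snd (pi y) = 0 -> fst (pi y) <> (0, 0) ->
              snd (pi (gcomm x y)) = 0 /\ fst (pi (gcomm x y)) <> (0, 0)).
    { intros y Hy Hy0. split; [apply (ext_snd_gcomm hA _ _ HE)|]. intros E.
      pose proof (ext_fst_gcomm hA x y HE Hy) as E'. rewrite E in E'.
      apply Hy0. apply (M2app_pow_fixed A (snd (pi x))); try easy.
      rewrite <- E'. now destruct (fst (pi y)). }
    assert (Hl : forall j, exists y, lcs M j y /\ snd (pi y) = 0 /\ fst (pi y) <> (0, 0)).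
    { induction j as [|j (y & Hy & Hy1 & Hy2)].
      - exists (gcomm x t1). split.
        (* [t1] may lie outside [M], but [[x, t1]] is [x] times the conjugate of [ginv x] by [t1],
           so normality puts it in [M]. *)
        + simpl. unfold gcomm. rewrite <- !gassoc, (gassoc _ t1).
          apply HM; [easy|]. apply Hnorm. now apply HM.
        + destruct Ht as (E1 & _). apply Hstep; now rewrite E1.
      - exists (gcomm x y). split; [|now apply Hstep].
        intros K HK HKg. apply HKg. now exists x, y. }
    destruct (Hl k) as (y & Hy & _ & Hy2). apply Hk in Hy. subst y. apply Hy2.
    rewrite (hom_id (pi : G -> GammaS_grp A hA)) by now apply (ext_hom hA HE).
    reflexivity.
Qed.

(** * Lattices in Sol_1^4 *)

Open Scope R_scope.

(** Matrix multiplication in the coordinates of [sol_mx], made into a [Grp] so that the universal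
    property of the presentation can produce maps into it. *)
Definition sol_grp : Grp.
Proof.
  refine (Build_Grp R4
    (fun g h => let '(x, y, z, u) := g in let '(x', y', z', u') := h in
                (x' + x * exp u', y + exp u * y', z + z' + x * y', u + u'))
    (0, 0, 0, 0)
    (fun g => let '(x, y, z, u) := g in
              (- x * exp (- u), - exp (- u) * y, - z + x * exp (- u) * y, - u)) _ _ _).
  - intros [[[x y] z] u] [[[x' y'] z'] u'] [[[x'' y''] z''] u''].
    rewrite !exp_plus. repeat (apply pair_equal_spec; split); ring.
  - intros [[[x y] z] u]. rewrite exp_0. repeat (apply pair_equal_spec; split); ring.
  - intros [[[x y] z] u].
    assert (E : exp (- u) * exp u = 1) by (rewrite <- exp_plus, Rplus_opp_l; apply exp_0).
    repeat (apply pair_equal_spec; split); try ring.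
    transitivity (x - x * (exp (- u) * exp u)); [ring|]. rewrite E. ring.
Defined.

Lemma sol_mx_mul (g h : sol_grp) :
  mx3_eq (sol_mx (gop g h)) (mmul3 (sol_mx g) (sol_mx h)).
Proof.
  destruct g as [[[x y] z] u], h as [[[x' y'] z'] u'].
  intros i j Hi Hj. unfold mmul3.
  destruct i as [|[|[|i]]]; [..|lia]; destruct j as [|[|[|j]]]; try lia; cbn;
    rewrite ?exp_plus; ring.
Qed.

Lemma sol_gpow_unip (x y z : R) (a : Z) :
  @gpow sol_grp (x, y, z, 0) a
  = (IZR a * x, IZR a * y, IZR a * z + x * y * (IZR a * (IZR a - 1) / 2), 0).
Proof.
  set (h := fun a => (IZR a * x, IZR a * y,
                      IZR a * z + x * y * (IZR a * (IZR a - 1) / 2), 0) : sol_grp).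
  assert (H1 : h 1%Z = (x, y, z, 0))
    by (unfold h; repeat (apply pair_equal_spec; split); try ring; field).
  rewrite <- H1. symmetry. apply (additive_gpow h).
  intros b c. unfold h. cbn [gop sol_grp]. rewrite plus_IZR, exp_0.
  repeat (apply pair_equal_spec; split); field.
Qed.

Lemma sol_gpow_diag (u : R) (n : Z) :
  @gpow sol_grp (0, 0, 0, u) n = (0, 0, 0, IZR n * u).
Proof.
  set (h := fun n => (0, 0, 0, IZR n * u) : sol_grp).
  assert (H1 : h 1%Z = (0, 0, 0, u))
    by (unfold h; repeat (apply pair_equal_spec; split); ring).
  rewrite <- H1. symmetry. apply (additive_gpow h).
  intros b c. unfold h. cbn [gop sol_grp]. rewrite plus_IZR.
  repeat (apply pair_equal_spec; split); ring.
Qed.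

(** The corner entry of [t1^a t2^b]; the last summand is the product term from multiplying the two
    powers. *)
Definition sol_height (x1 x2 y1 y2 z1 z2 : R) (a b : Z) : R :=
  IZR a * z1 + x1 * y1 * (IZR a * (IZR a - 1) / 2)
  + (IZR b * z2 + x2 * y2 * (IZR b * (IZR b - 1) / 2)) + IZR a * x1 * (IZR b * y2).

Lemma sol_word (x1 x2 y1 y2 z1 z2 z0 : R) (a b c : Z) :
  word ((x1, y1, z1, 0) : sol_grp) (x2, y2, z2, 0) (0, 0, z0, 0) a b c
  = (IZR a * x1 + IZR b * x2, IZR a * y1 + IZR b * y2,
     sol_height x1 x2 y1 y2 z1 z2 a b + IZR c * z0, 0).
Proof.
  unfold word, sol_height. rewrite !sol_gpow_unip. cbn [gop sol_grp]. rewrite exp_0.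
  repeat (apply pair_equal_spec; split); field.
Qed.

Lemma eigenvalue_exp (t : R) : 2 < t -> exists u, 0 < u /\ exp u + exp (- u) = t.
Proof.
  (* [l] is the larger root of [l^2 - t l + 1]. The roots have product 1, so [u = ln l] makes them
     [exp u] and [exp (- u)]. *)
  intros Ht. set (s := sqrt (t * t - 4)).
  assert (Hs : s * s = t * t - 4) by (apply sqrt_sqrt; nra).
  assert (Hs0 : 0 <= s) by apply sqrt_pos.
  set (l := (t + s) / 2). assert (Hl : 1 < l) by (unfold l; lra).
  assert (Hq : l * l = t * l - 1) by (unfold l; nra).
  exists (ln l). split.
  - rewrite <- ln_1. apply ln_increasing; lra.
  - rewrite exp_Ropp, exp_ln by lra.
    apply (Rmult_eq_reg_r l); [|lra]. rewrite Rmult_plus_distr_r, Rinv_l by lra. lra.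
Qed.

(** If it vanished, the diagonal entries would be integers with product 1, and the trace would be 2
    or -2. The entry serves below as first coordinate of both eigenvectors. *)
Lemma m21_neq0 (A : M2) : M2det A = 1%Z -> (m11 A + m22 A > 2)%Z -> m21 A <> 0%Z.
Proof.
  unfold M2det. intros H1 H2 H3. rewrite H3 in H1.
  assert (H : (m11 A * m22 A = 1)%Z) by lia.
  destruct (Z.mul_eq_1 _ _ H) as [E|E]; rewrite E in *; lia.
Qed.

(* [(x1, x2)] and [(y1, y2)] are left eigenvectors of [A] for the eigenvalues
   [exp (- u)] and [exp u]; [(z1, z2)] solves a linear system with matrix [A^T - I]. *)
Lemma sol_rep (A : M2) (q m1 m2 : Z) :
  M2det A = 1%Z -> (m11 A + m22 A > 2)%Z -> q <> 0%Z ->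
  exists u x1 x2 y1 y2 z1 z2 z0 : R,
    0 < u /\ x1 * y2 - x2 * y1 <> 0 /\ z0 <> 0 /\
    pres_rel A q m1 m2 ((x1, y1, z1, 0) : sol_grp) (x2, y2, z2, 0) (0, 0, 0, u) (0, 0, z0, 0).
Proof.
  intros hA htr hq. pose proof (m21_neq0 A hA htr) as hc.
  unfold M2det in hA. destruct A as [s11 s12 s21 s22]. cbn [m11 m12 m21 m22] in *.
  apply (f_equal IZR) in hA. rewrite minus_IZR, !mult_IZR in hA.
  apply Z.gt_lt, IZR_lt in htr. rewrite plus_IZR in htr.
  apply not_0_IZR in hc, hq.
  set (A := mkM2 s11 s12 s21 s22).
  destruct (eigenvalue_exp (IZR s11 + IZR s22) htr) as (u & Hu & Hsum).
  assert (Hee : exp (- u) * exp u = 1) by (rewrite <- exp_plus, Rplus_opp_l; apply exp_0).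
  assert (Hlt : exp (- u) < exp u) by (apply exp_increasing; lra).
  set (l := exp u) in *. set (l' := exp (- u)) in *.
  (* A left eigenvector for the eigenvalue [e] is [(s21, e - s11)]; its second eigenvector equation
     is the characteristic equation of [A]. *)
  set (x1 := IZR s21). set (x2 := l' - IZR s11).
  set (y1 := IZR s21). set (y2 := l - IZR s11).
  (* The commutator of [t1] and [t2] has corner entry [x1 * y2 - x2 * y1], which must equal
     [q * z0]. *)
  set (z0 := (x1 * y2 - x2 * y1) / IZR q).
  (* Conjugation by the diagonal [t3] preserves corner entries. [k1] and [k2] collect the terms free
     of [z1], [z2] on the right of the two conjugation relations, and Cramer's rule with determinant
     [d] then gives [z1], [z2]. *)
  set (k1 := x1 * y1 * (IZR s11 * (IZR s11 - 1) / 2) + x2 * y2 * (IZR s21 * (IZR s21 - 1) / 2)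
             + IZR s11 * x1 * (IZR s21 * y2) + IZR m1 * z0).
  set (k2 := x1 * y1 * (IZR s12 * (IZR s12 - 1) / 2) + x2 * y2 * (IZR s22 * (IZR s22 - 1) / 2)
             + IZR s12 * x1 * (IZR s22 * y2) + IZR m2 * z0).
  set (d := 2 - (IZR s11 + IZR s22)). assert (Hd : d <> 0) by (unfold d; lra).
  assert (Hd' : (IZR s11 - 1) * (IZR s22 - 1) - IZR s12 * IZR s21 = d)
    by (unfold d; lra).
  set (z1 := (IZR s21 * k2 - k1 * (IZR s22 - 1)) / d).
  set (z2 := (IZR s12 * k1 - k2 * (IZR s11 - 1)) / d).
  assert (Hz1 : IZR s11 * z1 + IZR s21 * z2 + k1 = z1).
  { apply (Rmult_eq_reg_r d); [|easy].
    transitivity (IZR s11 * (z1 * d) + IZR s21 * (z2 * d) + k1 * d); [ring|].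
    unfold z1, z2, Rdiv. rewrite !Rmult_assoc, Rinv_l, !Rmult_1_r by easy.
    rewrite <- Hd' at 1. ring. }
  assert (Hz2 : IZR s12 * z1 + IZR s22 * z2 + k2 = z2).
  { apply (Rmult_eq_reg_r d); [|easy].
    transitivity (IZR s12 * (z1 * d) + IZR s22 * (z2 * d) + k2 * d); [ring|].
    unfold z1, z2, Rdiv. rewrite !Rmult_assoc, Rinv_l, !Rmult_1_r by easy.
    rewrite <- Hd' at 1. ring. }
  assert (Hdet : x1 * y2 - x2 * y1 = IZR s21 * (l - l')) by (unfold x1, x2, y1, y2; ring).
  assert (Hdet0 : x1 * y2 - x2 * y1 <> 0)
    by (rewrite Hdet; apply Rmult_integral_contrapositive; split; [easy|lra]).
  assert (X1 : IZR s11 * x1 + IZR s21 * x2 = l' * x1) by (unfold x1, x2; ring).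
  assert (X2 : IZR s12 * x1 + IZR s22 * x2 = l' * x2) by (unfold x1, x2; nra).
  assert (Y1 : IZR s11 * y1 + IZR s21 * y2 = l * y1) by (unfold y1, y2; ring).
  assert (Y2 : IZR s12 * y1 + IZR s22 * y2 = l * y2) by (unfold y1, y2; nra).
  exists u, x1, x2, y1, y2, z1, z2, z0. split; [easy|]. split; [easy|]. split.
  { unfold z0, Rdiv. apply Rmult_integral_contrapositive. split; [easy|].
    now apply Rinv_neq_0_compat. }
  split; [|split; [|split; [|split; [|split]]]].
  - apply gcomm_unique. rewrite sol_gpow_unip. cbn [gop sol_grp]. rewrite !exp_0.
    repeat (apply pair_equal_spec; split); try ring. unfold z0. field. easy.
  - cbn [gop sol_grp]. rewrite !exp_0. repeat (apply pair_equal_spec; split); ring.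
  - cbn [gop sol_grp]. rewrite !exp_0. repeat (apply pair_equal_spec; split); ring.
  - cbn [gop sol_grp]. rewrite !exp_0. repeat (apply pair_equal_spec; split); ring.
  - apply conj_eq.
    change (gop (gop _ _) (gpow _ m1)) with
      (word ((x1, y1, z1, 0) : sol_grp) (x2, y2, z2, 0) (0, 0, z0, 0) s11 s21 m1).
    rewrite sol_word. cbn [gop sol_grp]. rewrite exp_0. fold l. rewrite X1, Y1.
    repeat (apply pair_equal_spec; split); try ring.
    + transitivity (x1 * (l' * l)); [rewrite Hee; ring|ring].
    + rewrite <- Hz1 at 1. unfold sol_height, k1. ring.
  - apply conj_eq.
    change (gop (gop _ _) (gpow _ m2)) with
      (word ((x1, y1, z1, 0) : sol_grp) (x2, y2, z2, 0) (0, 0, z0, 0) s12 s22 m2).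
    rewrite sol_word. cbn [gop sol_grp]. rewrite exp_0. fold l. rewrite X2, Y2.
    repeat (apply pair_equal_spec; split); try ring.
    + transitivity (x2 * (l' * l)); [rewrite Hee; ring|ring].
    + rewrite <- Hz2 at 1. unfold sol_height, k2. ring.
Qed.

Lemma IZR_mul_small (a : Z) (d : R) : Rabs (IZR a * d) < Rabs d -> a = 0%Z.
Proof.
  intros H. destruct (Z.eq_dec a 0) as [|Ha]; [easy|exfalso].
  rewrite Rabs_mult, Rabs_Zabs in H.
  assert (1 <= IZR (Z.abs a)) by (apply IZR_le; lia).
  pose proof (Rabs_pos d). nra.
Qed.

Lemma floor_exists (r : R) : exists n : Z, 0 <= r - IZR n <= 1.
Proof.
  exists (up r - 1)%Z. rewrite minus_IZR. pose proof (archimed r). lra.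
Qed.

Lemma Rabs_scale_le (s r : R) : 0 <= s <= 1 -> Rabs (s * r) <= Rabs r.
Proof.
  intros Hs. rewrite Rabs_mult, (Rabs_pos_eq s) by lra. pose proof (Rabs_pos r). nra.
Qed.

Lemma sol_mul_diag_unip (x y z u : R) (n : Z) :
  gop (@gpow sol_grp (0, 0, 0, u) n) (x, y, z, 0) = (x, exp (IZR n * u) * y, z, IZR n * u).
Proof.
  rewrite sol_gpow_diag. cbn [gop sol_grp].
  repeat (apply pair_equal_spec; split); ring.
Qed.

(** In the normal form [t3^n t1^a t2^b tau^c] the coordinate [u] sees only [n], then [x] and [y]
    determine [a] and [b] because [d] is nonzero, and then the corner entry determines [c].
    Discreteness and cocompactness are both proved in this order. *)
Lemma ext_sol_lattice {A : M2} (hA : M2det A = 1%Z) {P : Grp} {tau : P}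
  {pi : P -> (Z * Z) * Z} {t1 t2 t3 : P} {u x1 x2 y1 y2 z1 z2 z0 : R} (f : P -> sol_grp) :
  is_central_ext A P (gpow tau) pi -> is_lift pi t1 t2 t3 -> is_hom f ->
  0 < u -> x1 * y2 - x2 * y1 <> 0 -> z0 <> 0 ->
  f t1 = (x1, y1, z1, 0) -> f t2 = (x2, y2, z2, 0) -> f t3 = (0, 0, 0, u) ->
  f tau = (0, 0, z0, 0) -> sol_lattice_embedding P f.
Proof.
  intros HE Ht Hf Hu Hd Hz0 F1 F2 F3 F4.
  set (d := x1 * y2 - x2 * y1) in *.
  assert (Hform : forall n a b c, f (gop (gpow t3 n) (word t1 t2 tau a b c))
    = (IZR a * x1 + IZR b * x2, exp (IZR n * u) * (IZR a * y1 + IZR b * y2),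
       sol_height x1 x2 y1 y2 z1 z2 a b + IZR c * z0, IZR n * u)).
  { intros n a b c. rewrite Hf, (hom_gpow f), (hom_word f), F1, F2, F3, F4 by easy.
    now rewrite sol_word, sol_mul_diag_unip. }
  assert (Hnf : forall g, exists n a b c, g = gop (gpow t3 n) (word t1 t2 tau a b c)).
  { intros g. exists (snd (pi g)).
    set (h := gop (gpow t3 (- snd (pi g))) g).
    assert (Hh : snd (pi h) = 0%Z).
    { unfold h. rewrite (ext_snd _ _ HE).
      pose proof (pi_t1t2t3 hA 0 0 (- snd (pi g)) HE Ht) as E.
      rewrite !gpow_0, !gid_l in E. rewrite E. cbn [snd]. lia. }
    destruct (pi h) as [[a b] k] eqn:E. cbn [snd] in Hh. subst k.
    destruct (ext_fiber hA h _ HE (eq_trans E (eq_sym (pi_t1t2t3 hA a b 0 HE Ht)))) as [c Hc].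
    rewrite gpow_1, gpow_0, gid_r in Hc.
    exists a, b, c. unfold word. rewrite <- Hc. unfold h.
    rewrite gassoc, <- gpow_add, Z.add_opp_diag_r. now rewrite gpow_0, gid_l. }
  assert (Hdisc : exists eps, 0 < eps /\ forall g, R4_small eps (f g) -> g = gid).
  (* By Cramer's rule [a * d] and [b * d] are, up to sign, of the form [X * r - Y * s]. For
     [eps * K <= Rabs d] these are smaller than [Rabs d]; the summand 1 keeps [K] positive and the
     estimate strict. *)
  { set (K := 1 + Rabs x1 + Rabs x2 + Rabs y1 + Rabs y2).
    pose proof (Rabs_pos x1). pose proof (Rabs_pos x2).
    pose proof (Rabs_pos y1). pose proof (Rabs_pos y2).
    assert (HK : 0 < K) by (unfold K; lra).
    assert (Hda : 0 < Rabs d) by now apply Rabs_pos_lt.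
    assert (Hza : 0 < Rabs z0) by now apply Rabs_pos_lt.
    assert (HdK : 0 < Rabs d / K) by now apply Rdiv_lt_0_compat.
    set (eps := Rmin (Rmin u (Rabs z0)) (Rabs d / K)).
    assert (He : 0 < eps) by (unfold eps; repeat apply Rmin_glb_lt; easy).
    assert (Heu : eps <= u)
      by (eapply Rle_trans; [apply Rmin_l|apply Rmin_l]).
    assert (Hez : eps <= Rabs z0)
      by (eapply Rle_trans; [apply Rmin_l|apply Rmin_r]).
    assert (Hed : eps * K <= Rabs d).
    { assert (eps <= Rabs d / K) by apply Rmin_r.
      replace (Rabs d) with (Rabs d / K * K) by (field; lra). nra. }
    exists eps. split; [easy|]. intros g.
    destruct (Hnf g) as (n & a & b & c & ->). rewrite Hform.
    intros (Sx & Sy & Sz & Su).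
    assert (Hn : n = 0%Z).
    { apply (IZR_mul_small n u). rewrite (Rabs_pos_eq u) by lra. lra. }
    subst n. rewrite Rmult_0_l, exp_0, Rmult_1_l in Sy.
    set (X := IZR a * x1 + IZR b * x2) in *. set (Y := IZR a * y1 + IZR b * y2) in *.
    assert (Hlin : forall r s, Rabs r + Rabs s < K -> Rabs (X * r - Y * s) < Rabs d).
    { intros r s Hrs. eapply Rle_lt_trans; [apply Rabs_triang|].
      rewrite Rabs_Ropp, !Rabs_mult.
      pose proof (Rabs_pos r). pose proof (Rabs_pos s).
      pose proof (Rabs_pos X). pose proof (Rabs_pos Y). nra. }
    assert (Ha : a = 0%Z).
    { apply (IZR_mul_small a d). replace (IZR a * d) with (X * y2 - Y * x2)
        by (unfold X, Y, d; ring). apply Hlin. unfold K; lra. }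
    assert (Hb : b = 0%Z).
    { apply (IZR_mul_small b d). replace (IZR b * d) with (- (X * y1 - Y * x1))
        by (unfold X, Y, d; ring). rewrite Rabs_Ropp. apply Hlin. unfold K; lra. }
    subst a b.
    assert (Hc : c = 0%Z).
    { apply (IZR_mul_small c z0).
      replace (IZR c * z0) with (sol_height x1 x2 y1 y2 z1 z2 0 0 + IZR c * z0)
        by (unfold sol_height; field). lra. }
    subst c. unfold word. now rewrite !gpow_0, !gid_l. }
  split; [|split; [|split]].
  (* Injectivity follows from discreteness: [g h^-1] is sent to the identity, which is small. *)
  - intros g h E. destruct Hdisc as (eps & He & Hs).
    assert (Hg : gop g (ginv h) = gid).
    { apply Hs. rewrite Hf, (hom_inv f), E, ginv_r by easy.
      cbn. now rewrite Rabs_R0. }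
    apply (gcancel_r (ginv h)). now rewrite Hg, ginv_r.
  - intros g h. rewrite Hf. apply sol_mx_mul.
  - exact Hdisc.
  (* The remainder [k] is a product of rounding errors in the interval from 0 to 1 with the
     generators' coordinates; the factor [exp u] bounds the [exp ku] in [kx]. *)
  - set (B := exp u * (Rabs x1 + Rabs x2) + (Rabs y1 + Rabs y2) + Rabs z0 + u).
    exists B. intros [[[X Y] Z] U].
    destruct (floor_exists (U / u)) as [n Hn].
    set (ku := U - IZR n * u).
    assert (Hku : 0 <= ku <= u).
    { replace ku with ((U / u - IZR n) * u) by (unfold ku; field; lra). nra. }
    (* [X'] and [Y'] are [X] and [Y] freed of the exponentials that the product [f g * k]
       introduces; [al] and [be] are their coordinates in the basis [(x1, y1)], [(x2, y2)]. *)
    set (X' := X * exp (- ku)). set (Y' := exp (- (IZR n * u)) * Y).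
    set (al := (X' * y2 - Y' * x2) / d). set (be := (x1 * Y' - y1 * X') / d).
    assert (HX' : X' = al * x1 + be * x2) by (unfold al, be, d; field; exact Hd).
    assert (HY' : Y' = al * y1 + be * y2) by (unfold al, be, d; field; exact Hd).
    destruct (floor_exists al) as [a Ha]. destruct (floor_exists be) as [b Hb].
    set (x := IZR a * x1 + IZR b * x2). set (y := IZR a * y1 + IZR b * y2).
    set (ky := Y' - y). set (kx := exp ku * (X' - x)).
    set (h := sol_height x1 x2 y1 y2 z1 z2 a b).
    (* The exponent [c] is rounded last, since the corner entry of the product contains [x * ky]. *)
    destruct (floor_exists ((Z - h - x * ky) / z0)) as [c Hc].
    set (kz := Z - h - IZR c * z0 - x * ky).
    assert (Bx : Rabs (X' - x) <= Rabs x1 + Rabs x2).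
    { replace (X' - x) with ((al - IZR a) * x1 + (be - IZR b) * x2)
        by (rewrite HX'; unfold x; ring).
      eapply Rle_trans; [apply Rabs_triang|].
      apply Rplus_le_compat; now apply Rabs_scale_le. }
    assert (By : Rabs ky <= Rabs y1 + Rabs y2).
    { unfold ky. replace (Y' - y) with ((al - IZR a) * y1 + (be - IZR b) * y2)
        by (rewrite HY'; unfold y; ring).
      eapply Rle_trans; [apply Rabs_triang|].
      apply Rplus_le_compat; now apply Rabs_scale_le. }
    assert (Bz : Rabs kz <= Rabs z0).
    { replace kz with (((Z - h - x * ky) / z0 - IZR c) * z0)
        by (unfold kz; field; exact Hz0). now apply Rabs_scale_le. }
    assert (Bkx : Rabs kx <= exp u * (Rabs x1 + Rabs x2)).
    { unfold kx. rewrite Rabs_mult, (Rabs_pos_eq (exp ku)) by (left; apply exp_pos).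
      apply Rmult_le_compat; [left; apply exp_pos|apply Rabs_pos| |easy].
      destruct (Rle_lt_or_eq_dec ku u (proj2 Hku)) as [Hlt| ->]; [|apply Rle_refl].
      left. now apply exp_increasing. }
    exists (gop (gpow t3 n) (word t1 t2 tau a b c)), (kx, ky, kz, ku). split.
    + pose proof (Rabs_pos x1). pose proof (Rabs_pos x2). pose proof (exp_pos u).
      pose proof (Rabs_pos y1). pose proof (Rabs_pos y2). pose proof (Rabs_pos z0).
      pose proof (Rabs_pos kx).
      cbn. rewrite (Rabs_pos_eq ku) by lra. unfold B. repeat split; lra.
    + replace (X, Y, Z, U) with
        (@gop sol_grp (f (gop (gpow t3 n) (word t1 t2 tau a b c))) (kx, ky, kz, ku));
        [apply sol_mx_mul|].
      rewrite Hform. cbn [gop sol_grp]. fold x y h.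
      assert (Hk : exp (- ku) * exp ku = 1)
        by (rewrite <- exp_plus, Rplus_opp_l; apply exp_0).
      assert (Hm : exp (- (IZR n * u)) * exp (IZR n * u) = 1)
        by (rewrite <- exp_plus, Rplus_opp_l; apply exp_0).
      repeat (apply pair_equal_spec; split).
      * unfold kx, X'. transitivity (X * (exp (- ku) * exp ku)); [ring|]. rewrite Hk; ring.
      * unfold ky, Y'.
        transitivity (exp (- (IZR n * u)) * exp (IZR n * u) * Y); [ring|]. rewrite Hm; ring.
      * unfold kz. ring.
      * unfold ku. ring.
Qed.

Close Scope R_scope.

(** * The correspondence with invariants, the presentation and the lattice embedding *)

Theorem theorem5p1 (S : M2)
  (hdet : m11 S * m22 S - m12 S * m21 S = 1)
  (htr : m11 S + m22 S > 2) :
  exists Phi : CExt S -> Z * (Z * Z),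
    (* (1) Phi induces a bijection  {classes of central extensions} -> Z (+) Coker(S - I) *)
    (forall E1 E2 : CExt S,
        ext_equiv E1 E2 <->
        (fst (Phi E1) = fst (Phi E2) /\ coker_eq S (snd (Phi E1)) (snd (Phi E2)))) /\
    (forall (q : Z) (v : Z * Z), exists E : CExt S,
        fst (Phi E) = q /\ coker_eq S (snd (Phi E)) v) /\
    (* (2) for q <> 0 the corresponding extension is the presented group *)
    (forall q m1 m2 : Z, q <> 0 ->
      (exists (P : Grp) (t1 t2 t3 tau : P), is_presented S q m1 m2 P t1 t2 t3 tau) /\
      (forall (P : Grp) (t1 t2 t3 tau : P), is_presented S q m1 m2 P t1 t2 t3 tau ->
        (exists (pi : P -> (Z * Z) * Z) (H : is_central_ext S P (gpow tau) pi),
            pi t1 = ((1, 0), 0) /\ pi t2 = ((0, 1), 0) /\ pi t3 = ((0, 0), 1) /\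
            fst (Phi (mkCExt S P (gpow tau) pi H)) = q /\
            coker_eq S (snd (Phi (mkCExt S P (gpow tau) pi H))) (m1, m2)) /\
        solvable P /\
        is_nilradical (gen (fun x : P => x = t1 \/ x = t2 \/ x = tau)) /\
        exists rho : P -> R4, sol_lattice_embedding P rho)).
Proof.
  (* [Phi] picks one pair of invariants per extension by choice; only its class is canonical, by
     [has_inv_unique]. *)
  pose (Phi := fun E : CExt S =>
    proj1_sig (constructive_indefinite_description _ (has_inv_exists hdet E))).
  assert (HPhi : forall E, has_inv E (fst (Phi E)) (snd (Phi E)))
    by (intros E;
        exact (proj2_sig (constructive_indefinite_description _ (has_inv_exists hdet E)))).
  exists Phi. split; [|split].
  - intros E1 E2. split.
    + intros H. apply (has_inv_unique hdet E2); [|apply HPhi].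
      now apply (has_inv_transport E1).
    + intros [Hq Hv]. apply (has_inv_equiv hdet E1 E2 (fst (Phi E2)) (snd (Phi E2)));
        [|apply HPhi].
      apply (has_inv_shift E1 _ _ _ Hv). rewrite <- Hq. apply HPhi.
  - intros q [m1 m2].
    exists (mkCExt S _ _ _ (model_ext S hdet q m1 m2)).
    apply (has_inv_unique hdet _ _ _ _ _ (HPhi _)).
    exists model_t1, model_t2, model_t3. split; [easy|].
    cbn [cx_iota cx_grp fst snd]. rewrite gpow_1. apply model_pres.
  - intros q m1 m2 hq. split.
    + do 5 eexists. apply (model_presented S hdet).
    + intros P t1 t2 t3 tau HP. destruct (presented_ext hdet HP) as (pi & HE & Ht).
      split; [|split; [|split]].
      * exists pi, HE. destruct Ht as (E1 & E2 & E3). do 3 (split; [easy|]).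
        apply (has_inv_unique hdet _ _ _ _ _ (HPhi _)).
        exists t1, t2, t3. split; [easy|].
        cbn [cx_iota cx_grp fst snd]. rewrite gpow_1. apply HP.
      * now apply (ext_solvable hdet HE).
      * now apply (ext_nilradical hdet htr HE Ht).
      (* The matrices of [sol_rep] satisfy the relations, so the universal property of [P] supplies
         the homomorphism. *)
      * destruct (sol_rep S q m1 m2 hdet htr hq)
          as (u & x1 & x2 & y1 & y2 & z1 & z2 & z0 & Hu & Hd & Hz0 & HR).
        destruct (proj1 (proj2 HP _ _ _ _ _ HR)) as (f & Hf & F1 & F2 & F3 & F4).
        exists f. exact (ext_sol_lattice hdet f HE Ht Hf Hu Hd Hz0 F1 F2 F3 F4).
Qed.
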